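(* Let $\Omega\subset\mathbb{R}^N$ be a bounded open set, let $f\in L^N(\Omega)$ be nonnegative, and let $g=\lambda f\ge 0$ with $$\lambda<\frac{1}{S_{N,1}\,\|f\|_{L^N(\Omega)}}.$$ Then, for every $\gamma\ge 0$, the problem $$-\mathrm{div}\left(\frac{Du}{|Du|}\right)+\frac{|Du|}{(1-u)^{\gamma}}=g \ \text{ in } \Omega,\qquad u=0\ \text{ on }\partial\Omega,$$ has a solution $u\in BV(\Omega)$ (in the sense defined in the context).
   Context: $S_{N,p}$ denotes the (best) Sobolev constant, i.e. $\|u\|_{L^{p^*}(\Omega)}\le S_{N,p}\|Du\|_{L^p(\Omega)}$ for $u\in W_0^{1,p}(\Omega)$, $p^*=\frac{Np}{N-p}$; in particular $S_{N,1}=\frac{1}{N\omega_N^{1/N}}$, where $\omega_N$ is the volume of the unit ball of $\mathbb{R}^N$. $BV(\Omega)$ is the space of functions $u\in L^1(\Omega)$ whose distributional derivative $Du$ is a Radon measure with finite total variation; $Du=D^a u+D^j u+D^c u$ is its decomposition into absolutely continuous, jump and Cantor parts, and $u^*$ denotes the precise representative of $u$. $\mathcal{DM}_\infty(\Omega)$ is the set of $\mathbf{z}\in L^\infty(\Omega,\mathbb{R}^N)$ such that the distributional divergence $\mathrm{div}(\mathbf{z})$ is a bounded measure in $\Omega$. For $\mathbf{z}\in\mathcal{DM}_\infty(\Omega)$ and $u\in BV(\Omega)\cap L^\infty(\Omega)$, the (Anzellotti) pairing $(\mathbf{z},Du)$ is the distribution, which is in fact a Radon measure, given by $$\langle(\mathbf{z},Du),\varphi\rangle=-\int_\Omega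 u^*\varphi\,\mathrm{div}(\mathbf{z})-\int_\Omega u\,\mathbf{z}\cdot D\varphi\,dx,\qquad \varphi\in C_0^\infty(\Omega).$$ Definition of solution: $u\in BV(\Omega)$ is a solution of the problem if $0\le u<1$ a.e. in $\Omega$, $|D^j u|=0$, and there exists $\mathbf{z}\in\mathcal{DM}_\infty(\Omega)$ with $\|\mathbf{z}\|_{L^\infty(\Omega)}\le 1$ such that (i) $-\mathrm{div}(\mathbf{z})+\frac{|Du|}{(1-u)^\gamma}=g$ in $\mathcal{D}'(\Omega)$, where $\frac{|Du|}{(1-u)^\gamma}$ denotes the measure with density $(1-u^* )^{-\gamma}$ with respect to $|Du|$; (ii) $(\mathbf{z},Du)=|Du|$ as measures in $\Omega$; (iii) $u|_{\partial\Omega}=0$ in the trace sense. *)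

(* Defs.v *)
From HB Require Import structures.
From mathcomp Require Import all_boot all_order all_algebra.
From mathcomp Require Import all_classical all_reals all_analysis.

Set Implicit Arguments.
Unset Strict Implicit.
Unset Printing Implicit Defensive.

Import Order.TTheory GRing.Theory Num.Theory.
Import numFieldNormedType.Exports.

Local Open Scope classical_set_scope.
Local Open Scope ring_scope.

(* Row vectors carry the product sigma-algebra, generated by the coordinates;
   over the reals this is the Borel sigma-algebra. *)
Section measurable_rV.
Context {d} {T : sigmaRingType d} (n : nat).

Definition rV_coord (i : 'I_n) (x : 'rV[T]_n) : T := x ord0 i.

Let rV_set0 : g_sigma_preimage rV_coord set0.
Proof. exact: sigma_algebra0. Qed.

Let rV_setC A : g_sigma_preimage rV_coord A -> g_sigma_preimage rV_coord (~` A).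
Proof. exact: sigma_algebraC. Qed.

Let rV_bigcup (F : _^nat) : (forall i, g_sigma_preimage rV_coord (F i)) ->
  g_sigma_preimage rV_coord (\bigcup_i (F i)).
Proof. exact: sigma_algebra_bigcup. Qed.

HB.instance Definition _ := @isMeasurable.Build (measure_tuple_display d)
  'rV[T]_n (g_sigma_preimage rV_coord) rV_set0 rV_setC rV_bigcup.

End measurable_rV.

Section measurable_fun_rV.
Context {d d'} {T : measurableType d} {U : measurableType d'} (n : nat).

Lemma measurable_rV_coord (i : 'I_n) :
  measurable_fun [set: 'rV[T]_n] (fun x => x ord0 i).
Proof.
move=> _ Y mY; rewrite setTI; apply: sub_sigma_algebra => /=.
rewrite -bigcup_seq/=; exists i => /=; first by rewrite mem_index_enum.
by exists Y => //; rewrite setTI.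
Qed.

Lemma measurable_fun_rV (f : U -> 'rV[T]_n) :
  (forall i, measurable_fun [set: U] (fun x => f x ord0 i)) ->
  measurable_fun [set: U] f.
Proof.
move=> mf.
suff mfS : measurable `<=` image_set_system setT f measurable.
  by move=> _ A mA; exact: mfS.
apply: smallest_sub; first exact/sigma_algebra_image/sigma_algebra_measurable.
rewrite -bigcup_seq => _ [i _ [B mB <-]].
rewrite /image_set_system/= !setTI.
by have := mf i measurableT B mB; rewrite setTI.
Qed.

End measurable_fun_rV.

Section lebesgue_rV.
Context {R : realType}.

Definition rV_of_prod n (p : measurableTypeR R * 'rV[R]_n) : 'rV[R]_n.+1 :=
  row_mx p.1%:M p.2.
Definition prod_of_rV n (x : 'rV[R]_n.+1) : measurableTypeR R * 'rV[R]_n :=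
  (x ord0 ord0, \row_i x ord0 (lift ord0 i)).

Lemma rV_of_prodE n (p : measurableTypeR R * 'rV[R]_n) j : rV_of_prod p ord0 j =
  if unlift ord0 j is Some i then p.2 ord0 i else p.1.
Proof.
rewrite /rV_of_prod; case: unliftP => [i ->|->].
  have -> : lift ord0 i = rshift 1 i by exact: ord_inj.
  exact: row_mxEr.
have -> : ord0 = lshift n (ord0 : 'I_1) by exact: ord_inj.
by rewrite [LHS]row_mxEl mxE eqxx mulr1n.
Qed.

Lemma rV_of_prodK n : cancel (@rV_of_prod n) (@prod_of_rV n).
Proof.
move=> [a x]; rewrite /prod_of_rV !rV_of_prodE unlift_none/=; congr pair.
by apply/rowP => i; rewrite mxE rV_of_prodE liftK.
Qed.

Lemma measurable_rV_of_prod n :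
  measurable_fun [set: measurableTypeR R * 'rV[R]_n] (@rV_of_prod n).
Proof.
apply: measurable_fun_rV => i.
under eq_fun do rewrite rV_of_prodE.
case: unliftP => [j _|_]; last exact: measurable_fst.
exact: (measurableT_comp (measurable_rV_coord j) measurable_snd).
Qed.

Lemma measurable_prod_of_rV n :
  measurable_fun [set: 'rV[R]_n.+1] (@prod_of_rV n).
Proof.
apply/measurable_fun_pair; first exact: measurable_rV_coord.
by apply: measurable_fun_rV => i; under eq_fun do rewrite mxE;
  exact: measurable_rV_coord.
Qed.

Section leb_cons.
Variables (n : nat) (mu : {sigma_finite_measure set 'rV[R]_n -> \bar R}).

Definition leb_cons : set 'rV[R]_n.+1 -> \bar R :=
  pushforward (@lebesgue_measure R \x mu)%E (@rV_of_prod n).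

HB.instance Definition _ := Measure.copy leb_cons
  (@measure_function_pushforward__canonical__measure_function_Measure
    _ _ _ _ _ (@lebesgue_measure R \x mu)%E _ (@measurable_rV_of_prod n)).

Let leb_cons_sigma_finite : sigma_finite setT leb_cons.
Proof.
have /sigma_finiteP[F [TF ndF Foo]] := sigma_finiteT (@lebesgue_measure R).
have /sigma_finiteP[G [TG ndG Goo]] := sigma_finiteT mu.
exists (fun k => @prod_of_rV n @^-1` (F k `*` G k)).
  rewrite -preimage_bigcup -[LHS](preimage_setT (@prod_of_rV n)); congr preimage.
  apply/seteqP; split=> // -[x y] _.
  have [i _ Fix] : (\bigcup_i F i) x by rewrite -TF.
  have [j _ Gjy] : (\bigcup_i G i) y by rewrite -TG.
  exists (maxn i j) => //; split=> /=.
  - by move: x Fix; exact/subsetPset/ndF/leq_maxl.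
  - by move: y Gjy; exact/subsetPset/ndG/leq_maxr.
move=> k; have [mF Fk] := Foo k; have [mG Gk] := Goo k; split.
  by rewrite -[X in measurable X]setTI; apply: measurable_prod_of_rV => //;
    exact: measurableX.
rewrite /leb_cons /pushforward -comp_preimage.
rewrite (_ : _ \o _ = id); last by apply/funext => p /=; rewrite rV_of_prodK.
by rewrite preimage_id product_measure1E// lte_mul_pinfty// ge0_fin_numE.
Qed.

HB.instance Definition _ := Measure_isSigmaFinite.Build _ _ _ leb_cons
  leb_cons_sigma_finite.

End leb_cons.

(* N-dimensional Lebesgue measure, as an iterated product *)
Fixpoint lebesgue_rV n : {sigma_finite_measure set 'rV[R]_n -> \bar R} :=
  if n is m.+1 then leb_cons (lebesgue_rV m) else \d_(0 : 'rV[R]_0).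

Lemma measurable_rV_box n (A : 'I_n -> set R) : (forall i, measurable (A i)) ->
  measurable [set x : 'rV[R]_n | forall i, A i (x ord0 i)].
Proof.
move=> mA; rewrite (_ : [set _ | _] =
    \bigcap_(i in [set: 'I_n]) ((fun x : 'rV[R]_n => x ord0 i) @^-1` A i)).
  apply: fin_bigcap_measurable => // i _; rewrite -[X in measurable X]setTI.
  exact: measurable_rV_coord.
by apply/seteqP; split=> x /= h i; [move=> _; exact: h|exact: h].
Qed.

Lemma lebesgue_rV_box n (A : 'I_n -> set R) : (forall i, measurable (A i)) ->
  lebesgue_rV n [set x | forall i, A i (x ord0 i)] =
  (\prod_i @lebesgue_measure R (A i))%E.
Proof.
elim: n A => [|n IHn] A mA.
  by rewrite big_ord0 /= diracE mem_set// => -[].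
rewrite big_ord_recl /= /leb_cons /pushforward.
rewrite -IHn => [|i]; last exact: mA.
rewrite -product_measure1E; [|exact: mA|]; last first.
  by apply: (@measurable_rV_box _ (fun i => A (lift ord0 i))) => i; exact: mA.
congr (_ _); apply/seteqP; split=> [[a x]/= h|[a x] [/= h0 h] i]/=.
  split=> [|i] /=.
    by have := h ord0; rewrite rV_of_prodE unlift_none.
  by have := h (lift ord0 i); rewrite rV_of_prodE liftK.
by rewrite rV_of_prodE; case: unliftP => [j ->|->].
Qed.

End lebesgue_rV.

Section euclidean.
Context {R : realType} {N : nat}.
Implicit Types (x y : 'rV[R]_N) (A Omega : set 'rV[R]_N).

Definition dotv x y : R := \sum_i x ord0 i * y ord0 i.

(* The library norm on row vectors is the sup norm. *)
Definition enorm x : R := Num.sqrt (dotv x x).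

Definition eball x (r : R) : set 'rV[R]_N := [set y | enorm (y - x) < r].

Definition boundary A := closure A `\` interior A.

Definition diam A : \bar R :=
  ereal_sup [set (enorm (x - y))%:E | x in A & y in A].

(* Not normalised: the usual H^s is this measure times (omega_s / 2 ^ s), so both
   have the same null sets. With s = 0 it is the counting measure. *)
Definition hausdorff_measure (s : nat) A : \bar R :=
  ereal_sup [set ereal_inf
    [set (\sum_(0 <= k <oo) if `[< F k = set0 >] then 0 else diam (F k) ^+ s)%E
       | F in [set F : (set 'rV[R]_N)^nat |
           A `<=` \bigcup_k F k /\ forall k, (diam (F k) <= delta%:E)%E]]
     | delta in [set delta : R | 0 < delta]].

Definition unitv (i : 'I_N) : 'rV[R]_N := delta_mx ord0 i.

Definition partial (i : 'I_N) (phi : 'rV[R]_N -> R) : 'rV[R]_N -> R :=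
  fun x => 'D_(unitv i) phi x.

Definition gradv (phi : 'rV[R]_N -> R) x : 'rV[R]_N := \row_i partial i phi x.

Definition smooth (phi : 'rV[R]_N -> R) : Prop :=
  forall s : seq 'I_N, continuous (foldr partial phi s) /\
    forall i x, derivable (foldr partial phi s) x (unitv i).

(* C_0^oo(Omega) *)
Definition test_function Omega (phi : 'rV[R]_N -> R) : Prop :=
  let supp := closure [set x | phi x != 0] in
  [/\ smooth phi, compact supp & supp `<=` Omega].

End euclidean.

Notation leb := (lebesgue_rV _).

Section sobolev.
Context {R : realType}.
Local Open Scope ereal_scope.

Definition Lpnorm {N} (Omega : set 'rV[R]_N) (p : \bar R) (f : 'rV[R]_N -> R)
  : \bar R := 'N[leb]_p[EFin \o (f \_ Omega)].

Definition vLpnorm {N} (Omega : set 'rV[R]_N) (p : \bar R)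
  (F : 'rV[R]_N -> 'rV[R]_N) : \bar R := Lpnorm Omega p (enorm \o F).

(* u belongs to W_0^{1,p}(Omega), the closure of C_0^oo(Omega) in
   W^{1,p}(Omega), and Du is its weak gradient. *)
Definition W01p {N} (Omega : set 'rV[R]_N) (p : R)
    (u : 'rV[R]_N -> R) (Du : 'rV[R]_N -> 'rV[R]_N) : Prop :=
  [/\ measurable_fun Omega u, measurable_fun Omega Du &
   exists phi : nat -> 'rV[R]_N -> R,
   [/\ forall k, test_function Omega (phi k),
       Lpnorm Omega p%:E (fun x => phi k x - u x)%R @[k --> \oo] --> 0 &
       vLpnorm Omega p%:E (fun x => gradv (phi k) x - Du x)%R @[k --> \oo] --> 0]].

(* p^* = N p / (N - p); division in \bar R, so that 1^* = +oo when N = 1 *)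
Definition sobolev_exponent (N : nat) (p : R) : \bar R :=
  (N%:R * p)%:E / (N%:R - p)%:E.

(* S_{N,p}: the least constant that is valid on all bounded open sets *)
Definition sobolev_constant (N : nat) (p : R) : \bar R :=
  ereal_inf [set S%:E | S in [set S : R | (0 <= S)%R /\
    forall (Omega : set 'rV[R]_N) u Du,
      open Omega -> bounded_set Omega -> W01p Omega p u Du ->
      Lpnorm Omega (sobolev_exponent N p) u <= S%:E * vLpnorm Omega p%:E Du]].

End sobolev.

Section charges.
Context d (T : measurableType d) {R : realType}.
Implicit Types nu : {charge set T -> \bar R}.

Definition hahn_pos nu : set T := projT1 (cid (Hahn_decomposition nu)).
Definition hahn_neg nu : set T :=
  projT1 (cid (projT2 (cid (Hahn_decomposition nu)))).
Definition hahn_posneg nu : hahn_decomposition nu (hahn_pos nu) (hahn_neg nu) :=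
  projT2 (cid (projT2 (cid (Hahn_decomposition nu)))).

Definition charge_integral nu (D : set T) (f : T -> R) : R :=
  \int[jordan_pos (hahn_posneg nu)]_(x in D) f x -
  \int[jordan_neg (hahn_posneg nu)]_(x in D) f x.

(* A bounded measure in D is represented by a charge on the whole space that
   does not see the complement of D. *)
Definition charge_in (D : set T) nu : Prop :=
  forall A, measurable A -> A `&` D = set0 -> nu A = 0%E.

Definition vcharge_val {N} (nu : 'I_N -> {charge set T -> \bar R}) (A : set T)
  : 'rV[R]_N := \row_i fine (nu i A).

Definition total_variation {N} (nu : 'I_N -> {charge set T -> \bar R})
    (A : set T) : \bar R :=
  ereal_sup [set (\sum_(0 <= k <oo) (enorm (vcharge_val nu (F k)))%:E)%E
    | F in [set F : (set T)^nat | [/\ forall k, measurable (F k),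
        trivIset setT F & \bigcup_k F k = A]]].

(* m is the measure |nu|; it is determined by nu on all measurable sets. *)
Definition is_variation {N} (nu : 'I_N -> {charge set T -> \bar R})
    (m : {measure set T -> \bar R}) : Prop :=
  forall A, measurable A -> m A = total_variation nu A.

End charges.

Section BV.
Context {R : realType} {N : nat}.
Local Notation RN := ('rV[R]_N).
Local Notation chargeN := (charge RN R).
Implicit Types (Omega : set RN) (u : RN -> R) (z : RN -> RN).

(* u belongs to BV(Omega) and its distributional derivative is Du *)
Definition BV_derivative Omega u (Du : 'I_N -> chargeN) : Prop :=
  [/\ leb.-integrable Omega (EFin \o u), forall i, charge_in Omega (Du i) &
   forall phi, test_function Omega phi -> forall i,
     \int[leb]_(x in Omega) (u x * partial i phi x) =
     - charge_integral (Du i) Omega phi].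

Definition BV Omega u : Prop := exists Du, BV_derivative Omega u Du.

(* mean value of |u - a| over D r *)
Definition mean_dev u (D : R -> set RN) (a : R) (r : R) : \bar R :=
  ((leb (D r))^-1 * \int[leb]_(y in D r) `|u y - a|%:E)%E.

Definition approx_limit u (x : RN) (a : R) : Prop :=
  (mean_dev u (eball x) a r @[r --> 0^'+] --> 0)%E.

Definition half_ball (x nu : RN) (r : R) : set RN :=
  eball x r `&` [set y | 0 < dotv (y - x) nu].

(* u jumps at x between a (on the side of nu) and b *)
Definition approx_jump u (x : RN) (a b : R) (nu : RN) : Prop :=
  [/\ a != b, enorm nu = 1,
      (mean_dev u (half_ball x nu) a r @[r --> 0^'+] --> 0)%E &
      (mean_dev u (half_ball x (- nu)) b r @[r --> 0^'+] --> 0)%E].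

Definition discontinuity_set Omega u : set RN :=
  [set x | Omega x /\ ~ exists a, approx_limit u x a].

Definition jump_set Omega u : set RN :=
  [set x | Omega x /\ exists a b nu, approx_jump u x a b nu].

(* u^*: the approximate limit, or the average of the two one-sided limits at
   jump points; 0 on the remaining, |Du|-negligible set. *)
Definition precise_rep u (x : RN) : R :=
  xget 0 [set t | approx_limit u x t \/
    exists a b nu, approx_jump u x a b nu /\ t = (a + b) / 2].

(* Z carries the singular part of Du with respect to Lebesgue measure *)
Definition BV_decomposition Omega u (Du Da Dj Dc : 'I_N -> chargeN) : Prop :=
  exists Z : set RN, [/\ measurable Z, leb Z = 0%E,
    forall i, Da i `<< leb &
    forall i A, measurable A ->
     [/\ Da i A = Du i (A `\` Z),
         Dj i A = Du i (A `&` Z `&` jump_set Omega u) &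
         Dc i A = Du i (A `&` Z `\` discontinuity_set Omega u)]].

(* u has trace t at the boundary point x *)
Definition trace_at Omega u (x : RN) (t : R) : Prop :=
  ((r ^- N)%:E * \int[leb]_(y in Omega `&` eball x r) `|u y - t|%:E
     @[r --> 0^'+] --> 0)%E.

Definition zero_trace Omega u : Prop :=
  hausdorff_measure N.-1
    [set x | boundary Omega x /\ ~ trace_at Omega u x 0] = 0%E.

(* z belongs to DM_oo(Omega) and its distributional divergence is dz *)
Definition DMoo Omega z (dz : chargeN) : Prop :=
  [/\ measurable_fun Omega z, (vLpnorm Omega +oo z < +oo)%E,
      charge_in Omega dz &
   forall phi, test_function Omega phi ->
     \int[leb]_(x in Omega) dotv (z x) (gradv phi x) =
     - charge_integral dz Omega phi].

Definition pairing Omega z (dz : chargeN) u (phi : RN -> R) : R :=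
  - charge_integral dz Omega (fun x => precise_rep u x * phi x)
  - \int[leb]_(x in Omega) (u x * dotv (z x) (gradv phi x)).

(* (1 - u^* ) ^ (- gamma), equal to +oo where u^* = 1 and gamma > 0 *)
Definition absorption_density (gamma : R) u (x : RN) : \bar R :=
  (((1 - precise_rep u x) `^ gamma)%:E)^-1%E.

Definition is_solution Omega (gamma : R) (g u : RN -> R) : Prop :=
  exists (Du Da Dj Dc : 'I_N -> chargeN) (absDu : {measure set RN -> \bar R})
    (z : RN -> RN) (dz : chargeN),
  [/\ BV_derivative Omega u Du /\ is_variation Du absDu,
      {ae leb, forall x, Omega x -> 0 <= u x < 1},
      BV_decomposition Omega u Du Da Dj Dc /\ total_variation Dj Omega = 0%E,
      DMoo Omega z dz /\ (vLpnorm Omega +oo z <= 1)%E &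
   [/\
      (forall K, compact K -> K `<=` Omega ->
         absDu.-integrable K (absorption_density gamma u)) /\
      (forall phi, test_function Omega phi ->
         - charge_integral dz Omega phi
         + fine (\int[absDu]_(x in Omega)
                    ((phi x)%:E * absorption_density gamma u x))%E
         = \int[leb]_(x in Omega) (g x * phi x)),
      forall phi, test_function Omega phi ->
         pairing Omega z dz u phi = \int[absDu]_(x in Omega) phi x &
      zero_trace Omega u]].

End BV.

(* Main.v *)
Require Import Defs.
From HB Require Import structures.
From mathcomp Require Import all_boot all_order all_algebra.
From mathcomp Require Import all_classical all_reals all_analysis.
From mathcomp Require Import measurable_realfun ess_sup_inf ring lra.

Set Implicit Arguments.
Unset Strict Implicit.
Unset Printing Implicit Defensive.

Import Order.TTheory GRing.Theory Num.Theory.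
Import numFieldNormedType.Exports.

Local Open Scope classical_set_scope.
Local Open Scope ring_scope.

(** The zero function solves the problem.  For u = 0 the measure |Du| vanishes,
so the lower-order term, the identity (z, Du) = |Du| and the boundary condition
all trivialise, and what remains is to find a vector field z with |z| <= 1 and
- div z = g in Omega.  The smallness of lambda is exactly what makes such a
field exist.

By Hoelder's inequality with exponents N and N / (N - 1), and by the Sobolev
inequality with p = 1, every test function phi satisfies
int g phi <= lambda |f|_N S |grad phi|_1 <= int |grad phi|
([small_data_estimate]).  The constant sobolev_constant is an infimum that need
not be attained: the strict inequality on lambda leaves room for an admissible
constant S slightly above it.  If the infimum is infinite or lambda is negative,
the hypotheses force g = 0 almost everywhere and the estimate is trivial.

Consequently grad phi |-> int g phi is a linear functional on the space of
gradients, of norm at most one for the L^1 norm of vector fields built on the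
Euclidean norm.  The Hahn-Banach theorem ([hahn_banach_extension]) extends it to
all integrable vector fields, and a functional of norm at most one on L^1 is
integration against a field z with |z| <= 1 ([L1_dual_vector]); this field
satisfies int z . grad phi = int g phi ([exists_calibration]).

The Hahn-Banach theorem is obtained from minimal sublinear functionals, which
avoids handling partially defined functionals.  The duality is obtained from the
Radon-Nikodym theorem applied to A |-> T (1_A e_i), for each coordinate i; the
bound |z| <= 1 then follows by testing T on the fields 1_A q, q running through
the countably many rational vectors.

The divergence of z is the charge with density - g, and integrating against its
Jordan decomposition amounts to integrating against the density
([charge_integral_induced]).  Finally the precise representative of 0 is 0 at
every point, because balls and half-balls have positive finite Lebesgue measure
([precise_rep_cst0]). *)

(** * The Hahn-Banach theorem *)

Section sublinear.
Context {R : realType} {V : lmodType R}.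
Implicit Types (p q : V -> R) (x y : V).

(** Only the inequality p (a x) <= a p x is required: for a > 0 the reverse one
follows by applying it to 1 / a, see [sublinearZ]. *)
Definition sublinear p : Prop :=
  (forall x y, p (x + y) <= p x + p y) /\
  (forall a x, 0 <= a -> p (a *: x) <= a * p x).

Lemma sublinear0 p : sublinear p -> p 0 = 0.
Proof.
move=> [pD pZ]; apply/eqP; rewrite eq_le; apply/andP; split.
  by have := pZ 0 0 (lexx _); rewrite scale0r mul0r.
by have := pD 0 0; rewrite addr0; lra.
Qed.

Lemma sublinear_ge p x : sublinear p -> - p (- x) <= p x.
Proof.
move=> sp; have := sp.1 x (- x); rewrite subrr sublinear0//; lra.
Qed.

Lemma sublinearZ p a x : sublinear p -> 0 <= a -> p (a *: x) = a * p x.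
Proof.
move=> sp; rewrite le_eqVlt => /predU1P[<-|a0].
  by rewrite scale0r mul0r sublinear0.
apply/eqP; rewrite eq_le (sp.2 _ _ (ltW a0))/=.
have /(sp.2 _ (a *: x)) : 0 <= a^-1 by rewrite invr_ge0 ltW.
by rewrite scalerA mulVf ?gt_eqF// scale1r ler_pdivlMl.
Qed.

Section inf_family.
Context {I : Type} (A : set I) (f : I -> V -> R).
Hypothesis A0 : A !=set0.
Hypothesis flb : forall x, exists m, forall i, A i -> m <= f i x.

Definition inf_family x : R := inf [set f i x | i in A].

Lemma inf_family_le i x : A i -> inf_family x <= f i x.
Proof.
move=> Ai; apply: ge_inf; last by exists i.
by have [m mf] := flb x; exists m => _ [j Aj <-]; exact: mf.
Qed.

Lemma inf_family_ge x m : (forall i, A i -> m <= f i x) -> m <= inf_family x.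
Proof.
move=> mf; apply: lb_le_inf; last by move=> _ [i Ai <-]; exact: mf.
by have [i Ai] := A0; exists (f i x); exists i.
Qed.

(** The two constructions of the Hahn-Banach argument, the lower bound of a chain
and the perturbation of a functional along a direction or a subspace, are
pointwise infima; sublinearity of an infimum only needs the family to be stable
up to a smaller member. *)
Lemma sublinear_inf :
  (forall i j x y, A i -> A j ->
    exists2 k, A k & f k (x + y) <= f i x + f j y) ->
  (forall i a x, A i -> 0 <= a -> exists2 k, A k & f k (a *: x) <= a * f i x) ->
  sublinear inf_family.
Proof.
move=> fD fZ; split=> [x y|a x].
  rewrite -lerBlDr; apply: inf_family_ge => i Ai.
  rewrite lerBlDr -lerBlDl; apply: inf_family_ge => j Aj.
  have [k Ak] := fD i j x y Ai Aj.
  by rewrite lerBlDl; apply/le_trans/inf_family_le.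
rewrite le_eqVlt => /predU1P[<-|a0].
  have [i Ai] := A0; have [k Ak] := fZ i 0 x Ai (lexx _).
  by rewrite !mul0r; apply/le_trans/inf_family_le.
rewrite -ler_pdivrMl//; apply: inf_family_ge => i Ai.
have [k Ak] := fZ i a x Ai (ltW a0).
by rewrite ler_pdivrMl//; apply/le_trans/inf_family_le.
Qed.

End inf_family.

(** Given y, the functional x |-> inf_(t >= 0) q (x + t y) - t q y is sublinear and
lies below q, hence equals q by minimality; its term t = 1 gives
q x <= q (x + y) - q y, the superadditivity that q lacked. *)
Lemma minimal_sublinear_linear q : sublinear q ->
  (forall q', sublinear q' -> (forall x, q' x <= q x) ->
    forall x, q x <= q' x) ->
  (forall x y, q (x + y) = q x + q y) /\ (forall a x, q (a *: x) = a * q x).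
Proof.
move=> sq qmin.
have qD x y : q (x + y) = q x + q y.
  apply/eqP; rewrite eq_le sq.1/=.
  pose f t x := q (x + t *: y) - t * q y.
  have flb x' : exists m, forall t, [set t | 0 <= t] t -> m <= f t x'.
    exists (- q (- x')) => t /= t0; rewrite /f -sublinearZ//.
    have := sq.1 (x' + t *: y) (- x'); rewrite addrAC subrr add0r; lra.
  have nA : [set t : R | 0 <= t] !=set0 by exists 0 => /=.
  have sf : sublinear (inf_family [set t | 0 <= t] f).
    apply: sublinear_inf => // [s t a b /= s0 t0|t a x' /= t0 a0].
      exists (s + t); first exact: addr_ge0.
      have := sq.1 (a + s *: y) (b + t *: y).
      rewrite /f scalerDl (addrACA a b) mulrDl; lra.
    exists (a * t); first exact: mulr_ge0.
    rewrite /f -scalerA -scalerDr; have := sq.2 _ (x' + t *: y) a0; lra.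
  have fle x' : inf_family [set t | 0 <= t] f x' <= q x'.
    have : 0 <= 0 :> R by [].
    move=> /(inf_family_le flb (i := 0) x').
    by rewrite /f scale0r addr0 mul0r subr0.
  have : q x <= f 1 x.
    by apply: le_trans (qmin _ sf fle x) (inf_family_le flb _ _) => /=.
  by rewrite /f scale1r mul1r lerBrDr.
split=> // a x; have [a0|a0] := leP 0 a; first exact: sublinearZ.
have := qD (a *: x) (- a *: x); rewrite -scalerDl subrr scale0r.
rewrite sublinear0// (sublinearZ x sq (a := - a)) ?oppr_ge0 1?ltW//; lra.
Qed.

(** Zorn's lemma gives a minimal sublinear functional below p; a chain is bounded
below pointwise because every member satisfies q x >= - q (- x) >= - p (- x). *)
Theorem exists_linear_le_sublinear p : sublinear p -> exists T : V -> R,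
  [/\ forall x y, T (x + y) = T x + T y, forall a x, T (a *: x) = a * T x &
      forall x, T x <= p x].
Proof.
move=> sp; pose S := {q | sublinear q /\ forall x, q x <= p x}.
have p0 : S by exists p.
pose le_S : rel S := fun s t => `[< forall x, sval t x <= sval s x >].
have [||A Atot|[q [sq qp]] qmin] := @ZL_preorder S p0 le_S.
- by move=> q; apply/asboolP.
- move=> r q s /asboolP rq /asboolP qs; apply/asboolP => x.
  exact: le_trans (qs x) (rq x).
- have [[i Ai]|A0] := pselect (A !=set0); last first.
    by exists p0 => s As; case: A0; exists s.
  have nA : A !=set0 by exists i.
  pose f (i : S) := sval i.
  have flb x : exists m, forall j, A j -> m <= f j x.
    exists (- p (- x)) => -[j [sj jp]] _; rewrite /f/=.
    by apply: le_trans (sublinear_ge x sj); rewrite lerN2.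
  have sf : sublinear (inf_family A f).
    apply: sublinear_inf => // [j k x y Aj Ak|[j [sj jp]] a x Aj a0].
      have [/asboolP jk|/asboolP kj] := Atot _ _ Aj Ak.
        exists k => //; apply: (le_trans ((svalP k).1.1 _ _)).
        by rewrite lerD2r; exact: jk.
      exists j => //; apply: (le_trans ((svalP j).1.1 _ _)).
      by rewrite lerD2l; exact: kj.
    by exists (exist _ j (conj sj jp)) => //=; exact: sj.2.
  have fp x : inf_family A f x <= p x.
    exact: le_trans (inf_family_le flb _ Ai) ((svalP i).2 x).
  exists (exist _ (inf_family A f) (conj sf fp)) => s As.
  by apply/asboolP => x /=; exact: inf_family_le.
- exists q; have [|? ?] := minimal_sublinear_linear sq _; last by split.
  move=> r sr rq; have rp x : r x <= p x by exact: le_trans (rq x) (qp x).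
  by have /asboolP := qmin (exist _ r (conj sr rp)) (asboolT rq).
Qed.

End sublinear.

(** The subspace on which the functional is given is parametrised as D (A), with
A a subspace of W and D linear on A, and the functional itself is a function l
of the parameter.  It is then unnecessary to show that l u depends on D u only. *)
Section hahn_banach.
Context {R : realType} {W V : lmodType R}.
Variables (A : set W) (D : W -> V) (l : W -> R) (p : V -> R).
Hypotheses (A0 : A 0) (AD : forall u v, A u -> A v -> A (u + v)).
Hypothesis AZ : forall a u, A u -> A (a *: u).
Hypothesis DD : forall u v, A u -> A v -> D (u + v) = D u + D v.
Hypothesis DZ : forall a u, A u -> D (a *: u) = a *: D u.
Hypothesis lD : forall u v, A u -> A v -> l (u + v) = l u + l v.
Hypothesis lZ : forall a u, A u -> l (a *: u) = a * l u.
Hypothesis pD : forall x y, p (x + y) <= p x + p y.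
Hypothesis pZ : forall a x, p (a *: x) = `|a| * p x.
Hypothesis l_le : forall u, A u -> l u <= p (D u).

(** A linear functional below the infimum over u of this cost is bounded by p (take
u = 0), and at x = D u it is at most l u; replacing u with - u gives equality. *)
Let cost u x := p (x - D u) + l u.

Let pN x : p (- x) = p x.
Proof. by rewrite -scaleN1r pZ normrN1 mul1r. Qed.

Let p0 : p 0 = 0.
Proof. by rewrite -(scale0r 0) pZ normr0 mul0r. Qed.

Let cost_lb x : exists m, forall u, A u -> m <= cost u x.
Proof.
exists (- p x) => u Au; have := l_le (AZ (-1) Au).
rewrite lZ// DZ// mulN1r scaleN1r pN /cost => h.
have := pD x (D u - x); rewrite addrC subrK -(pN (_ - _)) opprB.
lra.
Qed.

Theorem hahn_banach_extension : exists T : V -> R,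
  [/\ forall x y, T (x + y) = T x + T y, forall a x, T (a *: x) = a * T x,
      forall x, T x <= p x & forall u, A u -> T (D u) = l u].
Proof.
have cost_sub : sublinear (inf_family A cost).
  apply: sublinear_inf => // [|u v x y Au Av|u a x Au a0]; first by exists 0.
    exists (u + v); first exact: AD.
    rewrite /cost lD// DD// opprD addrACA.
    by rewrite [leRHS]addrACA lerD2r pD.
  exists (a *: u); first exact: AZ.
  by rewrite /cost lZ// DZ// -scalerBr pZ ger0_norm// mulrDr.
have [T [TD TZ T_le]] := exists_linear_le_sublinear cost_sub.
have T_cost u x : A u -> T x <= cost u x.
  by move=> Au; apply: le_trans (T_le x) (inf_family_le cost_lb x _).
have T_l u : A u -> T (D u) <= l u.
  by move=> Au; have := T_cost _ (D u) Au; rewrite /cost subrr p0 add0r.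
exists T; split=> // [x|u Au].
  have := T_cost _ x (AZ 0 A0).
  by rewrite /cost lZ// DZ// scale0r subr0 mul0r addr0.
apply/eqP; rewrite eq_le T_l//=.
by have := T_l _ (AZ (-1) Au); rewrite DZ// TZ lZ// !mulN1r lerN2.
Qed.

End hahn_banach.

(** * Integrability and the Euclidean norm *)

Section integrable_EFin.
Context d (X : measurableType d) (R : realType).
Variables (mu : {measure set X -> \bar R}) (D : set X).
Local Notation int f := (mu.-integrable D (EFin \o f)).
Implicit Types f g : X -> R.

Lemma integrable_EFinD f g (mD : measurable D) : int f -> int g -> int (f \+ g).
Proof.
move=> fi gi; rewrite [EFin \o _](_ : _ = (EFin \o f) \+ (EFin \o g))%E//.
exact: integrableD.
Qed.

Lemma integrable_EFinZ a f (mD : measurable D) : int f -> int (a \*: f).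
Proof.
move=> fi; rewrite [EFin \o _](_ : _ = fun x => a%:E * (EFin \o f) x)%E//.
exact: integrableZl.
Qed.

Lemma integrable_EFinB f g (mD : measurable D) : int f -> int g -> int (f \- g).
Proof.
move=> fi gi; rewrite [EFin \o _](_ : _ = (EFin \o f) \- (EFin \o g))%E//.
exact: integrableB.
Qed.

Lemma integrable_EFin_measurable f : int f -> measurable_fun D f.
Proof. by move=> fi; apply/measurable_EFinP; exact: measurable_int fi. Qed.

Lemma integrable_EFinM_bounded (w f : X -> R) (M : R) : measurable D ->
  measurable_fun D w -> (forall x, D x -> `|w x| <= M) -> int f -> int (w \* f).
Proof.
move=> mD mw wM fi.
apply: (@integrableMr _ _ _ mu D mD w (EFin \o f)) => //.
exists M; split; [exact: num_real|move=> K MK x /= Dx].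
exact: le_trans (wM x Dx) (ltW MK).
Qed.

End integrable_EFin.

Section enorm.
Context {R : realType} {N : nat}.
Implicit Types (x y v : 'rV[R]_N) (a e : R).

Lemma dotvC x y : dotv x y = dotv y x.
Proof. by apply: eq_bigr => i _; rewrite mulrC. Qed.

Lemma dotvDl x y v : dotv (x + y) v = dotv x v + dotv y v.
Proof. by rewrite /dotv -big_split/=; apply: eq_bigr => i _; rewrite mxE mulrDl. Qed.

Lemma dotvZl a x y : dotv (a *: x) y = a * dotv x y.
Proof. by rewrite /dotv mulr_sumr; apply: eq_bigr => i _; rewrite mxE mulrA. Qed.

Lemma dotvBl x y v : dotv (x - y) v = dotv x v - dotv y v.
Proof. by rewrite dotvDl -scaleN1r dotvZl mulN1r. Qed.

Lemma dotv0l y : dotv 0 y = 0.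
Proof. by rewrite /dotv big1// => i _; rewrite mxE mul0r. Qed.

Lemma dotvv_ge0 x : 0 <= dotv x x.
Proof. by apply: sumr_ge0 => i _; rewrite -expr2 sqr_ge0. Qed.

Lemma enorm_ge0 x : 0 <= enorm x.
Proof. exact: sqrtr_ge0. Qed.

Lemma enorm_sqr x : enorm x ^+ 2 = dotv x x.
Proof. by rewrite sqr_sqrtr// dotvv_ge0. Qed.

Lemma enorm0 : enorm (0 : 'rV[R]_N) = 0.
Proof. by rewrite /enorm /dotv big1 ?sqrtr0// => i _; rewrite mxE mul0r. Qed.

Lemma enormZ a x : enorm (a *: x) = `|a| * enorm x.
Proof.
by rewrite /enorm dotvZl dotvC dotvZl mulrA -expr2 sqrtrM ?sqr_ge0// sqrtr_sqr.
Qed.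

Lemma enormN x : enorm (- x) = enorm x.
Proof. by rewrite -scaleN1r enormZ normrN1 mul1r. Qed.

Lemma abs_coord_le_enorm x i : `|x ord0 i| <= enorm x.
Proof.
rewrite -sqrtr_sqr; apply: ler_wsqrtr; rewrite /dotv (bigD1 i)//= expr2 lerDl.
by apply: sumr_ge0 => j _; rewrite -expr2 sqr_ge0.
Qed.

Lemma enorm_eq0 x : enorm x = 0 -> x = 0.
Proof.
move=> x0; apply/rowP => i; rewrite mxE; apply/eqP.
by rewrite -normr_le0 -x0 abs_coord_le_enorm.
Qed.

(** Cauchy-Schwarz, from the positivity of the square of |y| x - |x| y. *)
Lemma dotv_le x y : dotv x y <= enorm x * enorm y.
Proof.
have := dotvv_ge0 (enorm y *: x - enorm x *: y).
rewrite dotvBl !dotvZl ![dotv _ (_ - _)]dotvC !dotvBl !dotvZl (dotvC y x).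
rewrite -!enorm_sqr; have := enorm_ge0 x; have := enorm_ge0 y.
have [/enorm_eq0 ->|x0] := eqVneq (enorm x) 0.
  by move=> *; rewrite enorm0 mul0r dotv0l.
have [/enorm_eq0 ->|y0] := eqVneq (enorm y) 0.
  by move=> *; rewrite enorm0 mulr0 dotvC dotv0l.
move=> y_ge0 x_ge0.
have xy0 : 0 < enorm x * enorm y by rewrite mulr_gt0 ?lt0r ?x0 ?y0.
rewrite (_ : _ - _ = 2 * (enorm x * enorm y) * (enorm x * enorm y - dotv x y)).
  by rewrite pmulr_rge0 ?subr_ge0// mulr_gt0.
ring.
Qed.

Lemma ler_enormD x y : enorm (x + y) <= enorm x + enorm y.
Proof.
rewrite -ler_sqr ?nnegrE ?addr_ge0 ?enorm_ge0// enorm_sqr dotvDl.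
rewrite (dotvC x) (dotvC y) !dotvDl (dotvC y x) -!enorm_sqr.
have := dotv_le x y; rewrite sqrrD; lra.
Qed.

Lemma enorm_le_coord x e : 0 <= e -> (forall i, `|x ord0 i| <= e) ->
  enorm x <= Num.sqrt N%:R * e.
Proof.
move=> e0 xe; rewrite -[X in _ * X](ger0_norm e0) -sqrtr_sqr -sqrtrM//.
apply: ler_wsqrtr; rewrite mulr_natl -[X in _ *+ X]card_ord -sumr_const.
by apply: ler_sum => i _; rewrite -expr2 -real_normK ?num_real// ler_sqr ?nnegrE.
Qed.

(** Density of the rational vectors; the factor sqrt N + 1 in the proof converts a
coordinatewise approximation into a Euclidean one. *)
Lemma rational_row_approx x e : 0 < e ->
  exists q : 'rV[rat]_N, enorm (x - map_mx ratr q) <= e.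
Proof.
move=> e0; pose s : R := Num.sqrt N%:R + 1.
have s0 : 0 < s by rewrite ltr_wpDl ?sqrtr_ge0.
have es0 : 0 < e / s by rewrite divr_gt0.
have /choice[q qP] i : exists q : rat, ratr q \in `](x ord0 i - e / s), (x ord0 i + e / s)[.
  by apply: rat_in_itvoo; lra.
exists (\row_i q i); apply: le_trans (enorm_le_coord (ltW es0) _) _.
  move=> i; rewrite !mxE; have := qP i; rewrite in_itv/= => /andP[h1 h2].
  by rewrite ler_distlC; apply/andP; split; lra.
rewrite mulrA ler_pdivrMr// mulrC ler_wpM2l ?(ltW e0)//.
by rewrite /s lerDl.
Qed.

(** The closed unit ball is the intersection of countably many half-spaces: with q
close to x, the hypothesis becomes |x|^2 <= |x|. *)
Lemma enorm_le1_rational x :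
  (forall q : 'rV[rat]_N, dotv (map_mx ratr q) x <= enorm (map_mx ratr q : 'rV[R]_N)) ->
  enorm x <= 1.
Proof.
move=> qx; suff : enorm x ^+ 2 <= enorm x.
  have := enorm_ge0 x; rewrite le_eqVlt => /predU1P[<- _|x0]; first exact: ler01.
  by rewrite expr2 -[X in _ <= X]mulr1 ler_pM2l.
have c0 : 0 < 1 + enorm x by rewrite ltr_pwDl ?enorm_ge0.
apply/ler_addgt0Pl => e e0.
have [q qe] := rational_row_approx x (divr_gt0 e0 c0).
set p := map_mx ratr q in qe.
rewrite enorm_sqr -{1}(subrK p x) dotvDl.
have h1 := dotv_le (x - p) x; have h2 := qx q; rewrite -/p in h2.
have h3 : enorm p <= enorm x + enorm (x - p).
  by rewrite -(enormN (x - p)) (le_trans _ (ler_enormD _ _))// opprB addrC subrK.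
have h4 : enorm (x - p) * (1 + enorm x) <= e by rewrite -ler_pdivlMr.
lra.
Qed.

End enorm.

Section measurable_enorm.
Context d (X : measurableType d) {R : realType} {N : nat}.

Lemma measurable_dotv (D : set X) (F G : X -> 'rV[R]_N) :
  (forall i, measurable_fun D (fun x => F x ord0 i)) ->
  (forall i, measurable_fun D (fun x => G x ord0 i)) ->
  measurable_fun D (fun x => dotv (F x) (G x)).
Proof.
by move=> mF mG; apply: measurable_sum => i; exact: measurable_funM.
Qed.

Lemma measurable_enorm (D : set X) (F : X -> 'rV[R]_N) :
  (forall i, measurable_fun D (fun x => F x ord0 i)) ->
  measurable_fun D (fun x => enorm (F x)).
Proof.
move=> mF; apply: (@measurableT_comp _ _ _ _ _ _ (@Num.sqrt R)).
  by apply: continuous_measurable_fun; exact: sqrt_continuous.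
exact: measurable_dotv.
Qed.

Lemma integrable_enorm (mu : {measure set X -> \bar R}) (D : set X)
    (F : X -> 'rV[R]_N) : measurable D ->
  (forall i, mu.-integrable D (fun x => (F x ord0 i)%:E)) ->
  mu.-integrable D (fun x => (enorm (F x))%:E).
Proof.
move=> mD iF.
apply: (@le_integrable _ _ _ _ _ mD _ (fun x => \sum_(i < N) `|F x ord0 i|%:E)%E).
- apply/measurable_EFinP/measurable_enorm => i.
  exact: integrable_EFin_measurable (iF i).
- move=> x _; rewrite sumEFin !abse_EFin lee_fin ger0_norm ?enorm_ge0//.
  rewrite ger0_norm ?sumr_ge0//.
  have s0 : 0 <= \sum_(i < N) `|F x ord0 i| by exact: sumr_ge0.
  rewrite -ler_sqr ?nnegrE ?enorm_ge0// enorm_sqr expr2 mulr_sumr.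
  apply: ler_sum => i _; rewrite -expr2 -real_normK ?num_real// expr2.
  by rewrite ler_wpM2r// (bigD1 i)//= lerDl sumr_ge0.
- by apply: integrable_sum => // i _; exact: integrable_abse (iF i).
Qed.

End measurable_enorm.

(** * The dual of the space of integrable vector fields *)

Import HBSimple.

Section scalar_duality.
Local Open Scope charge_scope.
Context d (X : measurableType d) (R : realType).
Variable mu : {finite_measure set X -> \bar R}.
Local Notation int f := (mu.-integrable setT (EFin \o f)).

Lemma integrable_bounded (f : X -> R) (M : R) :
  measurable_fun setT f -> (forall x, `|f x| <= M) -> int f.
Proof.
move=> mf fM; apply: measurable_bounded_integrable => //.
  by rewrite fin_num_fun_lty// => A mA; exact: fin_num_measure.
exists M; split; [exact: num_real|move=> K MK x _ /=].
exact: le_trans (fM x) (ltW MK).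
Qed.

(** On the set A where w > c, the function w - c is positive and has a nonpositive
integral, so it vanishes almost everywhere there. *)
Lemma Rintegral_le_ae_le (w : X -> R) (c : R) : int w ->
  (forall A, measurable A -> \int[mu]_(x in A) w x <= c * fine (mu A)) ->
  {ae mu, forall x, w x <= c}.
Proof.
move=> iw wc; pose A := [set x | c < w x].
have mw : measurable_fun setT w by exact: integrable_EFin_measurable iw.
have mA : measurable A.
  rewrite -[A]setTI; have := mw measurableT `]c, +oo[%classic (measurable_itv _).
  by congr (measurable (_ `&` _)); apply/seteqP; split=> x /=;
    rewrite in_itv/= andbT.
have iwA : mu.-integrable A (EFin \o w) by exact: integrableS iw.
have icA : mu.-integrable A (EFin \o cst c).
  apply: (integrableS measurableT) => //.
  exact: finite_measure_integrable_cst.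
have iB : mu.-integrable A (EFin \o (w \- cst c)).
  exact: integrable_EFinB.
have /(ae_eq_integral_abs mu mA) : measurable_fun A (EFin \o (w \- cst c)).
  exact: measurable_int iB.
move=> [] H _; have {}H : ae_eq mu A (EFin \o (w \- cst c)) (cst 0%E).
  apply: H; apply/eqP; rewrite eq_le; apply/andP; split; last first.
    by apply: integral_ge0 => x _; exact: abse_ge0.
  have := wc A mA; rewrite -subr_le0.
  have -> : c * fine (mu A) = \int[mu]_(x in A) cst c x by rewrite Rintegral_cst.
  rewrite -RintegralB// /Rintegral -lee_fin fineK//; last first.
    exact: integrable_fin_num iB.
  apply: le_trans; rewrite le_eqVlt; apply/orP; left; apply/eqP.
  apply: eq_integral => x; rewrite inE /A/= => cw.
  by rewrite ger0_norm// subr_ge0 ltW.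
apply: filterS H => x /= H; rewrite leNgt; apply/negP => cw.
by have := H cw; case => /eqP; rewrite subr_eq0 gt_eqF.
Qed.

Variables (T : (X -> R) -> R) (C : R).
Hypothesis C0 : 0 <= C.
Hypothesis TD : forall f g, int f -> int g -> T (f \+ g) = T f + T g.
Hypothesis TZ : forall a f, int f -> T (a \*: f) = a * T f.
Hypothesis Tle : forall f, int f -> `|T f| <= C * \int[mu]_x `|f x|.

Let int_indic A : measurable A -> int (\1_A : X -> R).
Proof. by move=> mA; exact: integrable_indic. Qed.

Let T_indic_le A : measurable A -> `|T \1_A| <= C * fine (mu A).
Proof.
move=> mA; apply: le_trans (Tle (int_indic mA)) _.
rewrite le_eqVlt; apply/orP; left; apply/eqP; congr (_ * fine _).
under eq_integral do rewrite /= ger0_norm//.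
by rewrite integral_indic// setIT.
Qed.

(** The charge whose density with respect to mu represents the functional T. *)
Definition riesz_charge (A : set X) : \bar R := (T \1_A)%:E.

Let charge_set0 : riesz_charge set0 = 0%E.
Proof.
rewrite /riesz_charge; congr EFin.
by have := T_indic_le measurable0; rewrite measure0 mulr0 normr_le0 => /eqP.
Qed.

Let T_indicU A B : measurable A -> measurable B -> A `&` B = set0 ->
  T \1_(A `|` B) = T \1_A + T \1_B.
Proof.
move=> mA mB AB; rewrite -TD; [|exact: int_indic..]; congr T; apply/funext => x.
by rewrite indicE in_setU /= !indicE; move/seteqP: AB => [AB _];
  case: (boolP (x \in A)); case: (boolP (x \in B)); rewrite ?addr0 ?add0r//=;
  rewrite !inE => Bx Ax; have := AB x (conj Ax Bx).
Qed.

Let charge_finite A : measurable A -> riesz_charge A \is a fin_num.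
Proof. by []. Qed.

Let charge_sigma_additive : semi_sigma_additive riesz_charge.
Proof.
move=> F mF tF mUF.
(* What is left of the union after removing n sets: T is additive along the
   removal, and it is small on the remainder since |T 1_(D n)| <= C mu (D n). *)
pose D n := \bigcup_k F k `\` \big[setU/set0]_(i < n) F i.
have mD n : measurable (D n).
  by apply: measurableD => //; exact: bigsetU_measurable.
have TE n : T \1_(\bigcup_k F k) = \sum_(0 <= i < n) T \1_(F i) + T \1_(D n).
  elim: n => [|n IH].
    by rewrite big_nil add0r /D big_ord0 setD0.
  rewrite IH big_nat_recr//= -addrA; congr (_ + _).
  have DE : D n.+1 = D n `\` F n by rewrite /D big_ord_recr/= setDDl.
  rewrite -T_indicU//; last by rewrite DE setDIK.
  congr (T \1_ _); rewrite DE setDUK// => x Fx; split; first by exists n.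
  rewrite -bigcup_mkord => -[i /= ni Fix].
  by have ? := tF i n I I (ex_intro _ x (conj Fix Fx)); subst i; rewrite ltnn in ni.
have D0 : C * fine (mu (D n)) @[n --> \oo] --> 0.
  rewrite -[X in _ --> X](mulr0 C); apply: cvgMr.
  have capD : \bigcap_n D n = set0.
    apply/seteqP; split=> // x Dx; have [[k _ Fkx] _] := Dx 0%N I.
    by have [_] := Dx k.+1 I; apply; rewrite -bigcup_mkord; exists k => /=.
  have := @nonincreasing_cvg_mu _ _ _ mu D.
  rewrite capD measure0 => /(_ _ mD measurable0) H.
  have /fine_cvgP[_] : mu \o D @ \oo --> 0%E; last by [].
  apply: H; first by rewrite ltey_eq fin_num_measure.
  move=> m n mn; apply/subsetPset => x [Ux nx]; split=> //; apply: contra_not nx.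
  rewrite -!bigcup_mkord => -[i /= im Fix]; exists i => //=.
  exact: leq_trans im mn.
apply/fine_cvgP; split.
  by apply: nearW => n; rewrite /riesz_charge sumEFin.
apply/cvgrPdist_le => e e0; have /cvgrPdist_le/(_ e e0) := D0.
apply: filterS => n; rewrite sub0r normrN /= /riesz_charge sumEFin/= (TE n).
rewrite addrAC subrr add0r ger0_norm; last by rewrite mulr_ge0 ?fine_ge0.
move=> /(le_trans _); apply.
exact: T_indic_le.
Qed.

HB.instance Definition _ := isCharge.Build _ _ _ riesz_charge
  charge_set0 charge_finite charge_sigma_additive.

Let riesz_charge_dominated : riesz_charge `<< mu.
Proof.
apply/null_content_dominatesP => A mA muA; congr EFin.
by have := T_indic_le mA; rewrite muA mulr0 normr_le0 => /eqP.
Qed.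

(** The Radon-Nikodym derivative is bounded by C almost everywhere only; truncating
it at levels - C and C makes the bound hold everywhere. *)
Let density_indic : exists w : X -> R, [/\ measurable_fun setT w,
  forall x, `|w x| <= C &
  forall A, measurable A -> T \1_A = \int[mu]_(x in A) w x].
Proof.
pose v := 'd riesz_charge '/d mu.
have iv : mu.-integrable setT v.
  exact: Radon_Nikodym_integrable riesz_charge_dominated.
have vE x : (fine (v x))%:E = v x by rewrite fineK//; exact: Radon_Nikodym_fin_num.
have iw : int (fine \o v).
  by rewrite [EFin \o _](_ : _ = v)//; apply/funext => x /=; exact: vE.
have wE A : measurable A -> T \1_A = \int[mu]_(x in A) (fine \o v) x.
  move=> mA; rewrite /Rintegral; under eq_integral do rewrite /= vE.
  by rewrite -Radon_Nikodym_integral.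
have w_le : {ae mu, forall x, (fine \o v) x <= C}.
  apply: Rintegral_le_ae_le => // A mA; rewrite -wE//.
  exact: le_trans (ler_norm _) (T_indic_le mA).
have w_ge : {ae mu, forall x, (\- (fine \o v)) x <= C}.
  apply: Rintegral_le_ae_le => [|A mA].
    rewrite [EFin \o _](_ : _ = -%E \o (EFin \o (fine \o v)))//.
    exact: integrableN.
  have -> : \int[mu]_(x in A) (\- (fine \o v)) x = - T \1_A.
    rewrite wE//= -mulN1r -RintegralZl//; last exact: integrableS iw.
    by apply: eq_Rintegral => x _; rewrite mulN1r.
  by rewrite (le_trans (ler_norm _))// normrN T_indic_le.
have mv : measurable_fun setT (fine \o v).
  exact: integrable_EFin_measurable iw.
exists (fun x => Num.max (- C) (Num.min (fine (v x)) C)); split.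
- apply: measurable_maxr; first exact: measurable_cst.
  exact: measurable_minr.
- by move=> x; rewrite ler_norml le_max lexx/= ge_max ge_min lexx orbT ge0_cp.
- move=> A mA; rewrite wE//; congr fine; apply: ae_eq_integral => //.
  + by apply/measurable_EFinP; exact: measurable_funTS mv.
  + apply/measurable_EFinP; apply: measurable_funTS; apply: measurable_maxr.
      exact: measurable_cst.
    exact: measurable_minr.
  + apply: filterS2 w_le w_ge => x /= wC wC' _; congr EFin.
    by rewrite min_l// max_r// lerNl.
Qed.

(** The dual of L^1 is L^oo: both sides are linear and continuous for the L^1 norm,
and they agree on indicators, hence on simple functions, which are dense. *)
Lemma L1_dual_scalar : exists w : X -> R, [/\ measurable_fun setT w,
  forall x, `|w x| <= C &
  forall f, int f -> T f = \int[mu]_x (w x * f x)].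
Proof.
have [w [mw wC wE]] := density_indic; exists w; split=> // f intf.
have T0 : T (cst 0) = 0.
  have /= := Tle (integrable0 mu setT); under eq_Rintegral do rewrite normr0.
  by rewrite Rintegral_cst// mul0r mulr0 normr_le0 => /eqP.
have iwf g : int g -> int (w \* g).
  exact: integrable_EFinM_bounded measurableT mw (fun x _ => wC x).
have Tind A : measurable A -> T \1_A = \int[mu]_x (w x * \1_A x).
  move=> mA; rewrite wE// Rintegral_mkcond; apply: eq_Rintegral => x _.
  by rewrite patchE indicE; case: ifP => _; rewrite ?mulr1 ?mulr0.
have Tsfun (g : {sfun X >-> R}) : T g = \int[mu]_x (w x * g x).
  pose h s x := \sum_(y <- s) y * \1_(g @^-1` [set y]) x.
  suff hP s : int (h s) /\ T (h s) = \int[mu]_x (w x * h s x).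
    have -> : (g : X -> R) = h (finmap.enum_fset (fset_set (range g))).
      by apply/funext => x; rewrite /h -fsbig_finite//= -fimfunE.
    exact: (hP _).2.
  elim: s => [|y s [ih Th]].
    have -> : h [::] = cst 0 by apply/funext => x; rewrite /h big_nil.
    split; first exact: integrable0.
    by rewrite T0; under eq_Rintegral do rewrite mulr0; rewrite Rintegral_cst// mul0r.
  have mg : measurable (g @^-1` [set y]) by [].
  have iy : int (y \*: (\1_(g @^-1` [set y]) : X -> R)).
    apply: integrable_EFinZ => //; exact: int_indic.
  have -> : h (y :: s) = (y \*: \1_(g @^-1` [set y])) \+ h s.
    by apply/funext => x; rewrite /h big_cons.
  split; first exact: integrable_EFinD.
  rewrite TD// Th TZ//; last exact: int_indic.
  rewrite Tind// -RintegralZl//; last exact/iwf/int_indic.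
  rewrite -RintegralD//; last 2 first.
  - by apply: integrable_EFinZ => //; exact/iwf/int_indic.
  - exact: iwf.
  by apply: eq_Rintegral => x _ /=; rewrite mulrDr mulrCA.
have [g_ [ig_ _ /fine_cvgP[_ /cvgrPdist_le gf]]] :=
  approximation_sfun_integrable measurableT intf.
apply/eqP; rewrite -subr_eq0 -normr_le0; apply/ler_addgt0Pl => e e0.
have K0 : 0 < 2 * (C + 1) by rewrite mulr_gt0// ltr_wpDl.
have e'0 : 0 < e / (2 * (C + 1)) by rewrite divr_gt0.
have [n _ /(_ n (leqnn _))/=] := gf _ e'0; rewrite sub0r normrN addr0.
set I := fine _ => Ie.
have ifg : int (f \- g_ n).
  exact: integrable_EFinB.
have IE : I = \int[mu]_x `|(f \- g_ n) x| by [].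
have -> : T f = T (f \- g_ n) + T (g_ n).
  by rewrite -TD//; congr T; apply/funext => x /=; rewrite subrK.
have -> : \int[mu]_x (w x * f x) =
    \int[mu]_x (w x * (f \- g_ n) x) + \int[mu]_x (w x * g_ n x).
  rewrite -RintegralD//; [|exact: iwf..].
  by apply: eq_Rintegral => x _ /=; rewrite -mulrDr subrK.
rewrite Tsfun opprD addrACA subrr addr0.
have wI : `|\int[mu]_x (w x * (f \- g_ n) x)| <= C * I.
  apply: (le_trans (le_normr_Rintegral _ _)) => //; first exact: iwf.
  rewrite IE -RintegralZl//; last exact: integrable_norm.
  apply: le_Rintegral => //; first by apply: integrable_norm; exact: iwf.
    by apply: integrable_EFinZ => //; exact: integrable_norm.
  by move=> x _; rewrite normrM ler_wpM2r.
rewrite (le_trans (ler_normB _ _))//.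
rewrite (le_trans (lerD (Tle ifg) wI))//.
have I0 : 0 <= I by rewrite IE; apply: Rintegral_ge0.
rewrite -IE; move: Ie; rewrite ger0_norm// ler_pdivlMr//.
by move=> ?; nra.
Qed.

End scalar_duality.

Section vector_duality.
Context d (X : measurableType d) (R : realType) (N : nat).
Variable mu : {finite_measure set X -> \bar R}.
Local Notation int f := (mu.-integrable setT (EFin \o f)).
Implicit Types F G : 'I_N -> X -> R.

Definition row_fun F (x : X) : 'rV[R]_N := \row_i F i x.

Variable T : ('I_N -> X -> R) -> R.
Hypothesis TD : forall F G, (forall i, int (F i)) -> (forall i, int (G i)) ->
  T (fun i => F i \+ G i) = T F + T G.
Hypothesis TZ : forall a F, (forall i, int (F i)) ->
  T (fun i => a \*: F i) = a * T F.
Hypothesis Tle : forall F, (forall i, int (F i)) ->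
  T F <= \int[mu]_x enorm (row_fun F x).

Let single (i : 'I_N) (f : X -> R) : 'I_N -> X -> R :=
  fun j => if j == i then f else cst 0.

Let int_single (i : 'I_N) f : int f -> forall j, int (single i f j).
Proof.
by move=> fi j; rewrite /single; case: ifP => // _; exact: integrable0.
Qed.

Let enorm_single (i : 'I_N) f x : enorm (row_fun (single i f) x) = `|f x|.
Proof.
rewrite -sqrtr_sqr; congr Num.sqrt; rewrite /dotv (bigD1 i)//= big1 ?addr0.
  by rewrite mxE /single eqxx expr2.
by move=> j /negbTE ji; rewrite mxE /single ji mul0r.
Qed.

Let coordinate_density (i : 'I_N) : exists w : X -> R, [/\ measurable_fun setT w,
  forall x, `|w x| <= 1 &
  forall f, int f -> T (single i f) = \int[mu]_x (w x * f x)].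
Proof.
apply: L1_dual_scalar => // [f g fi gi|a f fi|f fi].
- rewrite -TD; [|exact: int_single..]; congr T; apply/funext => j.
  apply/funext => x /=.
  by rewrite /single; case: ifP => //= _; rewrite addr0.
- rewrite -TZ; last exact: int_single; congr T; apply/funext => j.
  apply/funext => x /=.
  by rewrite /single; case: ifP => //= _; rewrite scaler0.
- rewrite mul1r ler_norml; apply/andP; split.
    have iN j : int (-1 \*: single i f j).
      by apply: integrable_EFinZ => //; exact: int_single.
    rewrite lerNl; have <- := mulN1r (T (single i f)); rewrite -TZ; last exact: int_single.
    apply: (le_trans (@Tle _ iN)).
    rewrite le_eqVlt; apply/orP; left; apply/eqP; apply: eq_Rintegral => x _.
    rewrite -(enorm_single i) -[RHS]mul1r -[X in X * _]normrN1 -enormZ.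
    by congr enorm; apply/rowP => j; rewrite !mxE.
  apply: (le_trans (@Tle _ (int_single i fi))).
  rewrite le_eqVlt; apply/orP; left; apply/eqP; apply: eq_Rintegral => x _.
  exact: enorm_single.
Qed.

(** The scalar duality in each coordinate gives a field v representing T.  Testing T
on 1_A q gives int_A q . v <= |q| mu A for all A, so q . v <= |q| almost
everywhere, simultaneously for all rational q, that is |v| <= 1; on the remaining
null set the field is replaced by 0. *)
Lemma L1_dual_vector : exists z : X -> 'rV[R]_N,
  [/\ forall i, measurable_fun setT (fun x => z x ord0 i),
  forall x, enorm (z x) <= 1 &
  forall F, (forall i, int (F i)) -> T F = \int[mu]_x dotv (z x) (row_fun F x)].
Proof.
have [w wP] := choice coordinate_density.
pose v x := row_fun w x.
have mv i : measurable_fun setT (fun x => v x ord0 i).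
  by under eq_fun do rewrite mxE; have [] := wP i.
have iwf i f : int f -> int (w i \* f).
  have [mw w1 _] := wP i.
  exact: integrable_EFinM_bounded measurableT mw (fun x _ => w1 x).
have TE F : (forall i, int (F i)) -> T F = \int[mu]_x dotv (v x) (row_fun F x).
  move=> Fi.
  (* Only finitely many coordinates are involved: induction on the list of those
     that are kept. *)
  pose G s : 'I_N -> X -> R := fun j x => \sum_(i <- s) single i (F i) j x.
  suff GP s : [/\ forall j, int (G s j),
      int (fun x => \sum_(i <- s) w i x * F i x) &
      T (G s) = \int[mu]_x (\sum_(i <- s) w i x * F i x)].
    have -> : F = G (index_enum 'I_N).
      apply/funext => j; apply/funext => x; rewrite /G (bigD1 j)//= big1 ?addr0.
        by rewrite /single eqxx.
      by move=> i /negbTE ij; rewrite /single eq_sym ij.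
    have [_ _ ->] := GP (index_enum 'I_N); apply: eq_Rintegral => x _.
    rewrite /dotv; apply: eq_bigr => i _; rewrite !mxE; congr (_ * _).
    rewrite /G (bigD1 i)//= big1 ?addr0; first by rewrite /single eqxx.
    by move=> j /negbTE ji; rewrite /single eq_sym ji.
  elim: s => [|i s [ih iw Th]].
    have G0 : G [::] = (fun=> cst 0).
      by apply/funext => j; apply/funext => x; rewrite /G big_nil.
    rewrite G0; split.
    - by move=> j; exact: integrable0.
    - by under eq_fun do rewrite big_nil; exact: integrable0.
    - under eq_Rintegral do rewrite big_nil; rewrite Rintegral_cst// mul0r.
      rewrite (_ : (fun=> cst 0) = fun j => 0 \*: (cst 0 : X -> R)); last first.
        by apply/funext => j; apply/funext => x /=; rewrite scale0r.
      by rewrite (TZ 0 (F := fun=> cst 0)) ?mul0r// => j; exact: integrable0.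
  have GE : G (i :: s) = fun j => single i (F i) j \+ G s j.
    by apply/funext => j; apply/funext => x; rewrite /G big_cons.
  have wE : (fun x => \sum_(j <- i :: s) w j x * F j x) =
      (w i \* F i) \+ (fun x => \sum_(j <- s) w j x * F j x).
    by apply/funext => x; rewrite big_cons.
  rewrite GE; split.
  - by move=> j; apply: integrable_EFinD => //; exact: int_single.
  - by rewrite wE; apply: integrable_EFinD => //; exact: iwf.
  - rewrite TD//; last exact: int_single.
    rewrite Th; have [_ _ ->//] := wP i; rewrite -RintegralD//; last exact: iwf.
    by apply: eq_Rintegral => x _; rewrite big_cons.
have v1q (q : 'rV[rat]_N) :
    {ae mu, forall x, dotv (map_mx ratr q) (v x) <= enorm (map_mx ratr q : 'rV[R]_N)}.
  set p := map_mx ratr q.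
  have ip : int (fun x => dotv p (v x)).
    rewrite (_ : _ \o _ = fun x => (\sum_i (p ord0 i)%:E * (v x ord0 i)%:E)%E).
      apply: integrable_sum => // i _; apply: integrableZl => //.
      have [mw w1 _] := wP i; apply: (@integrable_bounded _ _ _ mu _ 1) => [|x].
        exact: mv.
      by rewrite mxE.
    by apply/funext => x /=; rewrite -sumEFin.
  apply: Rintegral_le_ae_le => // A mA.
  pose F i : X -> R := p ord0 i \*: \1_A.
  have iF i : int (F i).
    apply: integrable_EFinZ; first exact: measurableT.
    exact: integrable_indic.
  have rF x : row_fun F x = \1_A x *: p.
    by apply/rowP => i; rewrite mxE [RHS]mxE; exact: mulrC.
  have -> : \int[mu]_(x in A) dotv p (v x) = T F.
    rewrite TE// Rintegral_mkcond; apply: eq_Rintegral => x _.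
    rewrite rF dotvC dotvZl patchE indicE.
    by case: ifP => _; rewrite ?mul1r ?mul0r.
  apply: le_trans (Tle iF) _.
  have -> : enorm p * fine (mu A) = \int[mu]_(x in A) cst (enorm p) x.
    by rewrite Rintegral_cst.
  rewrite [leRHS]Rintegral_mkcond le_eqVlt; apply/orP; left; apply/eqP.
  apply: eq_Rintegral => x _; rewrite rF enormZ patchE indicE.
  by case: ifP => _; rewrite ?normr1 ?normr0 ?mul1r ?mul0r.
have v1 : {ae mu, forall x, enorm (v x) <= 1}.
  have : {ae mu, forall x, forall n : nat, if unpickle n is Some q then
      dotv (map_mx ratr q) (v x) <= enorm (map_mx ratr q : 'rV[R]_N) else true}.
    apply: ae_foralln => n; case: unpickle => [q|]; first exact: v1q.
    exact: aeW.
  apply: filterS => x vx; apply: enorm_le1_rational => q.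
  by have := vx (pickle q); rewrite pickleK.
pose z x := if enorm (v x) <= 1 then v x else 0.
have mz i : measurable_fun setT (fun x => z x ord0 i).
  have -> : (fun x => z x ord0 i) =
      (fun x => if enorm (v x) <= 1 then v x ord0 i else 0).
    by apply/funext => x; rewrite /z; case: ifP; rewrite // mxE.
  apply: measurable_fun_ifT => //.
  apply: measurable_fun_ler => //; exact: measurable_enorm.
exists z; split=> // [x|F iF].
  by rewrite /z; case: ifP => // _; rewrite enorm0.
rewrite TE//; congr fine; apply: ae_eq_integral => //.
- apply/measurable_EFinP/measurable_dotv => // i.
  under eq_fun do rewrite mxE; exact: integrable_EFin_measurable (iF i).
- apply/measurable_EFinP/measurable_dotv => // i.
  under eq_fun do rewrite mxE; exact: integrable_EFin_measurable (iF i).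
- by apply: filterS v1 => x vx _; rewrite /z vx.
Qed.

End vector_duality.

(** * Lebesgue measure and the topology of row vectors *)

Section cube.
Context {R : realType} {N : nat}.
Implicit Types (x y a : 'rV[R]_N) (U : set 'rV[R]_N) (r : R).

(** The balls of the sup norm; they are boxes, whose Lebesgue measure is explicit. *)
Definition cube x r : set 'rV[R]_N :=
  [set y | forall i, ball (x ord0 i) r (y ord0 i)].

Lemma measurable_cube x r : measurable (cube x r).
Proof.
by apply: (measurable_rV_box (A := fun i => ball (x ord0 i) r)) => i;
  exact: measurable_ball.
Qed.

Lemma leb_cube x r : 0 <= r -> leb (cube x r) = ((r *+ 2) ^+ N)%:E.
Proof.
move=> r0; rewrite (lebesgue_rV_box (A := fun i => ball (x ord0 i) r)).
  under eq_bigr do rewrite lebesgue_measure_ball//.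
  by rewrite prodEFin prodr_const card_ord.
by move=> i; exact: measurable_ball.
Qed.

Lemma ball_cube x r y : 0 < r -> cube x r y -> ball x r y.
Proof. by move=> r0 xy; split=> // i j; rewrite ord1; exact: xy. Qed.

Lemma nbhs_cube U x : nbhs x U -> exists2 r, 0 < r & cube x r `<=` U.
Proof.
move=> /nbhs_ballP[r /= r0 rU]; exists r => // y xy.
exact/rU/ball_cube.
Qed.

(** The sigma-algebra is generated by the coordinates, so an open set has to be
written as a countable union of cubes with rational centre. *)
Lemma open_measurable_rV U : open U -> measurable U.
Proof.
move=> oU.
pose F (c : 'rV[rat]_N * nat) : set 'rV[R]_N :=
  let C := cube (map_mx ratr c.1) c.2.+1%:R^-1 in
  if `[< C `<=` U >] then C else set0.
have -> : U = \bigcup_c F c; last first.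
  apply: countable_bigcupT_measurable; first exact: countableP.
  by move=> c; rewrite /F; case: asboolP => // _; exact: measurable_cube.
apply/seteqP; split=> [x Ux|x [c _]]; last first.
  by rewrite /F; case: asboolP => // CU /CU.
have [r r0 xrU] : exists2 r, 0 < r & cube x r `<=` U.
  by apply: nbhs_cube; exact: open_nbhs_nbhs.
have [k] := ltr_add_invr (divr_gt0 r0 (@ltr0Sn R 1)).
rewrite add0r => kr; set e := k.+1%:R^-1 in kr.
have e0 : 0 < e by rewrite invr_gt0.
have [q qe] : exists q : 'rV[rat]_N, enorm (x - map_mx ratr q) <= e / 2.
  by apply: rational_row_approx; rewrite divr_gt0.
have qx i : `|x ord0 i - ratr (q ord0 i)| < e.
  have := abs_coord_le_enorm (x - map_mx ratr q) i; rewrite !mxE; lra.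
exists (q, k) => //; rewrite /F /=; case: asboolP => [_ i|[]].
  by rewrite mxE /ball/= distrC; exact: qx.
move=> y yq; apply: xrU => i; have := yq i; have := qx i.
rewrite mxE /ball/= -/e => h1 h2.
have := ler_distD (ratr (q ord0 i)) (x ord0 i) (y ord0 i).
by rewrite (distrC _ (y ord0 i)) in h2 *; lra.
Qed.

Lemma enorm_lipschitz_continuous (f : 'rV[R]_N -> R) (K : R) : 0 <= K ->
  (forall x y, `|f x - f y| <= K * enorm (x - y)) -> continuous f.
Proof.
move=> K0 fK x; apply/(@cvgrPdist_lt _ _ _ (nbhs x) (nbhs_filter x)) => e e0.
pose s := K * Num.sqrt N%:R + 1.
have s0 : 0 < s by rewrite ltr_wpDl// mulr_ge0// sqrtr_ge0.
have es0 : 0 < e / s by rewrite divr_gt0.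
apply/nbhs_ballP; exists (e / s) => //= y [_ xy].
apply: le_lt_trans (fK _ _) _.
have h : enorm (x - y) <= Num.sqrt N%:R * (e / s).
  apply: enorm_le_coord; first exact: ltW.
  by move=> i; rewrite !mxE ltW//; exact: xy.
apply: le_lt_trans (ler_wpM2l K0 h) _.
by rewrite !mulrA ltr_pdivrMr// mulrC ltr_pM2l// /s ltrDl.
Qed.

Lemma continuous_enormB a : continuous (fun x => enorm (x - a)).
Proof.
apply: (@enorm_lipschitz_continuous _ 1) => // x y; rewrite mul1r.
have h1 := ler_enormD (x - y) (y - a); have h2 := ler_enormD (y - x) (x - a).
rewrite !addrA !subrK in h1 h2; rewrite -(enormN (y - x)) opprB in h2.
by rewrite ler_distl; apply/andP; split; lra.
Qed.

Lemma continuous_dotvB a v : continuous (fun x => dotv (x - a) v).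
Proof.
apply: (@enorm_lipschitz_continuous _ (enorm v)) => [|x y].
  exact: enorm_ge0.
rewrite -dotvBl opprB addrA subrK.
have h1 := dotv_le (x - y) v.
have := dotv_le (y - x) v; rewrite -(opprB x) enormN -scaleN1r dotvZl mulN1r => h2.
by rewrite ler_norml mulrC; apply/andP; split; lra.
Qed.

Lemma continuous_measurable_rV (f : 'rV[R]_N -> R) :
  continuous f -> measurable_fun setT f.
Proof.
move=> cf; apply: (measurability _ (RGenOpens.measurableE R)) => _ [_ [a [b ->] <-]].
rewrite setTI; apply: open_measurable_rV; exact: open_comp.
Qed.

(** An open set contains a cube around each of its points. *)
Lemma open_leb_gt0 U x : open U -> U x -> (0 < leb U)%E.
Proof.
move=> oU Ux; have [|r r0 rU] := @nbhs_cube U x; first exact: open_nbhs_nbhs.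
apply: (@lt_le_trans _ _ (leb (cube x r))).
  by rewrite leb_cube ?(ltW r0)// lte_fin exprn_gt0// pmulrn_lgt0.
apply: le_measure => //; rewrite inE; first exact: measurable_cube.
exact: open_measurable_rV.
Qed.

Lemma abs_coord_le_norm x i : `|x ord0 i| <= `|x|.
Proof.
rewrite [leRHS]/Num.norm/= mx_normrE.
by rewrite (le_bigmax _ (fun ij => `|x ij.1 ij.2|) (ord0, i)).
Qed.

Lemma bounded_leb_lty U : measurable U -> bounded_set U -> (leb U < +oo)%E.
Proof.
move=> mU [M [_ MU]]; pose K := `|M| + 1.
have MK : M < K by rewrite ltr_pwDr// ler_norm.
have K0 : 0 <= K + 1 by rewrite !addr_ge0.
apply: (@le_lt_trans _ _ (leb (cube 0 (K + 1)))); last by rewrite leb_cube// ltry.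
apply: le_measure => //; rewrite ?inE//; first exact: measurable_cube.
move=> x Ux i; rewrite mxE /ball/= sub0r normrN ltr_pwDr//.
exact: le_trans (abs_coord_le_norm x i) (MU K MK x Ux).
Qed.

Lemma open_eball a r : open (eball a r).
Proof.
have -> : eball a r = (fun y => enorm (y - a)) @^-1` [set t | t < r] by [].
apply: open_comp; last exact: open_lt.
by move=> x _; exact: continuous_enormB.
Qed.

Lemma open_half_ball a v r : open (half_ball a v r).
Proof.
apply: openI; first exact: open_eball.
have -> : [set y | 0 < dotv (y - a) v] =
   (fun y => dotv (y - a) v) @^-1` [set t | 0 < t] by [].
apply: open_comp; last exact: open_gt.
by move=> x _; exact: continuous_dotvB.
Qed.

Lemma leb_eball_lty a r : (leb (eball a r) < +oo)%E.
Proof.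
have [r0|r0] := leP 0 r; last first.
  rewrite (_ : eball a r = set0) ?measure0//; apply/seteqP; split=> // y /=.
  by move=> yr; have := enorm_ge0 (y - a); rewrite leNgt (lt_trans yr r0).
apply: (@le_lt_trans _ _ (leb (cube a r))); last by rewrite leb_cube// ltry.
apply: le_measure => //; rewrite ?inE.
- by apply: open_measurable_rV; exact: open_eball.
- exact: measurable_cube.
move=> y yr i; rewrite /ball/= distrC; apply: le_lt_trans yr.
by have := abs_coord_le_enorm (y - a) i; rewrite !mxE.
Qed.

End cube.

Section restricted_measure.
Context d (X : measurableType d) (R : realType).
Variables (mu : {measure set X -> \bar R}) (D : set X).
Hypotheses (mD : measurable D) (muD : (mu D < +oo)%E).
Local Notation nu := (mfrestr mD muD).

Let nuC : nu (~` D) = 0%E.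
Proof. by rewrite /mfrestr /mrestr setICl measure0. Qed.

Let integral_nu_in (f : X -> \bar R) :
  (\int[nu]_(x in D) f x = \int[mu]_(x in D) f x)%E.
Proof.
by apply: eq_measure_integral => A mA AD; rewrite /= /mfrestr /mrestr setIidl.
Qed.

(** The complement of D is negligible for the restricted measure, so integrals over
the whole space reduce to integrals over D. *)
Lemma integrable_mfrestr (f : X -> \bar R) : measurable_fun setT f ->
  mu.-integrable D f -> nu.-integrable setT f.
Proof.
move=> mf /integrableP[_ fD]; apply/integrableP; split=> //.
rewrite (ge0_negligible_integral (measurableC mD) measurableT _ _ nuC)//.
  by rewrite setTD setCK integral_nu_in.
exact: measurableT_comp.
Qed.

Lemma integral_mfrestr (f : X -> \bar R) : nu.-integrable setT f ->
  (\int[nu]_x f x = \int[mu]_(x in D) f x)%E.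
Proof.
move=> fi; rewrite (negligible_integral (measurableC mD) measurableT fi nuC).
by rewrite setTD setCK integral_nu_in.
Qed.

Lemma Rintegral_mfrestr (f : X -> R) : nu.-integrable setT (EFin \o f) ->
  \int[nu]_x f x = \int[mu]_(x in D) f x.
Proof. by move=> fi; congr fine; exact: integral_mfrestr. Qed.

End restricted_measure.

(** * Test functions *)

Section test_functions.
Context {R : realType} {N : nat}.
Implicit Types (phi psi : 'rV[R]_N -> R) (Omega : set 'rV[R]_N).

Lemma partialD i phi psi x : derivable phi x (unitv i) ->
  derivable psi x (unitv i) ->
  partial i (phi \+ psi) x = partial i phi x + partial i psi x.
Proof. by move=> h1 h2; exact: deriveD. Qed.

Lemma partialZ i a phi x : derivable phi x (unitv i) ->
  partial i (a \*: phi) x = a * partial i phi x.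
Proof. by move=> h; exact: deriveZ. Qed.

Lemma iter_partialD phi psi s : smooth phi -> smooth psi ->
  foldr partial (phi \+ psi) s = foldr partial phi s \+ foldr partial psi s.
Proof.
move=> sphi spsi; elim: s => //= i s ->; apply/funext => x.
by rewrite partialD//; [exact: (sphi s).2|exact: (spsi s).2].
Qed.

Lemma iter_partialZ a phi s : smooth phi ->
  foldr partial (a \*: phi) s = a \*: foldr partial phi s.
Proof.
move=> sphi; elim: s => //= i s ->; apply/funext => x.
by rewrite partialZ//; exact: (sphi s).2.
Qed.

Lemma smooth_cst0 : smooth (cst 0 : 'rV[R]_N -> R).
Proof.
move=> s; have -> : foldr partial (cst 0 : 'rV[R]_N -> R) s = cst 0.
  by elim: s => //= i s ->; apply/funext => x; exact: derive_cst.
by split=> [|i] x; [exact: cst_continuous|exact: derivable_cst].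
Qed.

Lemma smoothD phi psi : smooth phi -> smooth psi -> smooth (phi \+ psi).
Proof.
move=> sphi spsi s; rewrite iter_partialD//.
have [cphi dphi] := sphi s; have [cpsi dpsi] := spsi s.
by split=> [x|i x]; [exact: (@cvgD _ _ _ (nbhs x) (nbhs_filter x) _ _ _ _ (cphi x) (cpsi x))|exact: derivableD].
Qed.

Lemma smoothZ a phi : smooth phi -> smooth (a \*: phi).
Proof.
move=> sphi s; rewrite iter_partialZ//; have [cphi dphi] := sphi s.
by split=> [x|i x]; [exact: (@cvgZl_tmp _ _ _ (nbhs x) (nbhs_filter x) a _ _ (cphi x))|exact: derivableZ].
Qed.

Lemma test_function0 Omega : test_function Omega (cst 0).
Proof.
have supp0 : closure [set x : 'rV[R]_N | cst (0 : R) x != 0] = set0.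
  rewrite (_ : mkset _ = set0) ?closure0//; apply/seteqP; split=> // x /=.
  by rewrite eqxx.
split; first exact: smooth_cst0.
- by rewrite [X in compact X]supp0; exact: compact0.
- by rewrite [X in X `<=` _]supp0; exact: sub0set.
Qed.

Lemma test_functionD Omega phi psi : test_function Omega phi ->
  test_function Omega psi -> test_function Omega (phi \+ psi).
Proof.
move=> [sphi kphi phiO] [spsi kpsi psiO].
have sub : closure [set x | (phi \+ psi) x != 0] `<=`
    closure [set x | phi x != 0] `|` closure [set x | psi x != 0].
  rewrite -closureU; apply: closure_subset => x /=; apply: contra_neqP.
  by move=> /not_orP[/negP/negPn/eqP -> /negP/negPn/eqP ->]; rewrite addr0.
split; first exact: smoothD.
- apply: subclosed_compact sub; first exact: closed_closure.
  exact: compactU.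
- by apply: subset_trans sub _ => x [/phiO|/psiO].
Qed.

Lemma test_functionZ Omega a phi : test_function Omega phi ->
  test_function Omega (a \*: phi).
Proof.
move=> [sphi kphi phiO].
have sub : closure [set x | (a \*: phi) x != 0] `<=` closure [set x | phi x != 0].
  apply: closure_subset => x /=; apply: contra_neq => ->; exact: scaler0.
split; first exact: smoothZ.
- by apply: subclosed_compact sub; first exact: closed_closure.
- exact: subset_trans sub _.
Qed.

Lemma test_function_continuous Omega phi : test_function Omega phi ->
  continuous phi.
Proof. by move=> [sphi _ _]; exact: (sphi [::]).1. Qed.

Lemma test_function_partial_continuous Omega phi i : test_function Omega phi ->
  continuous (partial i phi).
Proof. by move=> [sphi _ _]; exact: (sphi [:: i]).1. Qed.

(** A bounded set is contained in a closed box, which is compact. *)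
Lemma continuous_bounded Omega phi : bounded_set Omega -> continuous phi ->
  exists M, forall x, Omega x -> `|phi x| <= M.
Proof.
move=> [M [_ OM]] cphi; pose K := `|M| + 1.
have MK : M < K by rewrite ltr_pwDr// ler_norm.
pose B := [set v : 'rV[R]_N | forall i, v ord0 i \in `[- K, K]].
have kB : compact B.
  apply: (@rV_compact _ _ (fun=> `[- K, K]%classic)) => _.
  exact: segment_compact.
have OB x : Omega x -> B x.
  move=> Ox i; rewrite in_itv/= -ler_norml.
  exact: le_trans (abs_coord_le_norm x i) (OM K MK x Ox).
have : compact (phi @` B).
  by apply: continuous_compact => //; exact: continuous_subspaceT.
move=> /compact_bounded[L [_ phiL]]; exists (`|L| + 1) => x Ox.
apply: (phiL (`|L| + 1)); first by rewrite ltr_pwDr// ler_norm.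
by exists x => //; exact: OB.
Qed.

Lemma integrable_continuous Omega phi : open Omega -> bounded_set Omega ->
  continuous phi -> leb.-integrable Omega (EFin \o phi).
Proof.
move=> oO bO cphi; have mO := open_measurable_rV oO.
apply: measurable_bounded_integrable => //; first exact: bounded_leb_lty.
  by apply: measurable_funTS; exact: continuous_measurable_rV.
have [M phiM] := continuous_bounded bO cphi.
exists M; split; [exact: num_real|move=> K MK x /= Ox].
exact: le_trans (phiM x Ox) (ltW MK).
Qed.

End test_functions.

(** * The estimate for small data *)

Section hoelder_endpoint.
Local Open Scope ereal_scope.
Context d (X : measurableType d) (R : realType).
Variable mu : {measure set X -> \bar R}.

(** The endpoint case of the Hoelder inequality, which is the one needed in
dimension one, where the Sobolev exponent of p = 1 is infinite. *)
Lemma hoelder_1_oo (f g : X -> R) : 0 < mu setT ->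
  measurable_fun setT f -> measurable_fun setT g ->
  'N[mu]_1[EFin \o (f \* g)%R] <= 'N[mu]_1[EFin \o f] * 'N[mu]_+oo[EFin \o g].
Proof.
move=> mu0 mf mg; rewrite !Lnorm1.
have -> : 'N[mu]_+oo[EFin \o g] = ess_sup mu (abse \o (EFin \o g)).
  by rewrite unlock /Lnorm mu0.
set e := ess_sup mu _.
have e0 : 0 <= e by apply: ess_sup_gee => //; apply: nearW => x; exact: abse_ge0.
have mnf : measurable_fun setT (fun x => `|(EFin \o f) x|).
  by do 2 apply: measurableT_comp => //.
rewrite muleC -ge0_integralZl//.
apply: ae_ge0_le_integral => //.
- by do 2 apply: measurableT_comp => //; exact: measurable_funM.
- by move=> x _; rewrite mule_ge0.
- exact: measurable_funeM.
- have := ess_sup_ge mu (abse \o (EFin \o g)); apply: filterS => x xe _.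
  by rewrite /= normrM EFinM muleC lee_wpmul2r.
Qed.

End hoelder_endpoint.

Section sobolev_hoelder.
Local Open Scope ereal_scope.
Context {R : realType} {N : nat}.
Variables (Omega : set 'rV[R]_N).
Hypotheses (N0 : (0 < N)%N) (oO : open Omega) (bO : bounded_set Omega).
Implicit Types (f phi : 'rV[R]_N -> R).

Let mO : measurable Omega. Proof. exact: open_measurable_rV. Qed.

Lemma Lpnorm1E f : Lpnorm Omega 1 f = \int[leb]_(x in Omega) `|f x|%:E.
Proof.
rewrite /Lpnorm Lnorm1 [RHS]integral_mkcond; apply: eq_integral => x _.
by rewrite /= !patchE; case: ifP => // _; rewrite normr0.
Qed.

(** N and the Sobolev exponent N / (N - 1) of p = 1 are conjugate. *)
Lemma Lpnorm_hoelder_critical f phi :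
  measurable_fun setT (f \_ Omega) -> measurable_fun setT (phi \_ Omega) ->
  \int[leb]_(x in Omega) `|f x * phi x|%:E <=
    Lpnorm Omega N%:R%:E f * Lpnorm Omega (sobolev_exponent N 1) phi.
Proof.
move=> mf mphi; rewrite -Lpnorm1E.
have -> : Lpnorm Omega 1 (f \* phi)%R =
    'N[leb]_1[EFin \o ((f \_ Omega) \* (phi \_ Omega))%R].
  by apply: eq_Lnorm => x /=; rewrite !patchE; case: ifP => // _; rewrite mulr0.
rewrite /Lpnorm /sobolev_exponent mulr1.
have [N1|N1] := eqVneq N 1%N.
  have -> : (N%:R%:E / (N%:R - 1)%:E : \bar R) = +oo.
    by rewrite N1 subrr inve0 mul1e.
  have -> : N%:R%:E = 1 :> \bar R by rewrite N1.
  apply: hoelder_1_oo => //; apply: (@open_leb_gt0 _ _ setT 0) => //.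
  exact: openT.
have N2 : (0 < N%:R - 1 :> R)%R.
  by rewrite subr_gt0 ltr1n ltn_neqAle eq_sym N1.
have -> : (N%:R%:E / (N%:R - 1)%:E : \bar R) = (N%:R / (N%:R - 1))%:E.
  by rewrite inver gt_eqF// EFinM.
apply: hoelder => //.
- by rewrite ltr0n.
- by rewrite divr_gt0// ltr0n.
- by rewrite invf_div -[X in (X + _)%R]mul1r -mulrDl subrKC divff// pnatr_eq0 -lt0n.
Qed.

(** A test function is its own approximating sequence, so the Sobolev inequality
applies to it. *)
Lemma test_function_W01p phi : test_function Omega phi ->
  W01p Omega 1 phi (gradv phi).
Proof.
move=> tphi; split.
- apply: measurable_funTS; apply: continuous_measurable_rV.
  exact: test_function_continuous tphi.
- apply: measurable_funTS; apply: measurable_fun_rV => i.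
  under eq_fun do rewrite mxE; apply: continuous_measurable_rV.
  exact: test_function_partial_continuous tphi.
- exists (fun=> phi); split=> //.
    rewrite (_ : (fun=> _) = cst 0); first exact: cvg_cst.
    apply/funext => k; rewrite Lpnorm1E integral0_eq// => x _.
    by rewrite subrr normr0.
  rewrite (_ : (fun=> _) = cst 0); first exact: cvg_cst.
  apply/funext => k; rewrite /vLpnorm Lpnorm1E integral0_eq// => x _.
  by rewrite /= subrr enorm0 normr0.
Qed.

Lemma integrable_test_function phi : test_function Omega phi ->
  leb.-integrable Omega (EFin \o phi).
Proof.
by move=> tphi; apply: integrable_continuous => //;
  exact: test_function_continuous tphi.
Qed.

Lemma integrable_test_partial phi i : test_function Omega phi ->
  leb.-integrable Omega (EFin \o partial i phi).
Proof.
by move=> tphi; apply: integrable_continuous => //;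
  exact: test_function_partial_continuous tphi.
Qed.

Lemma integrable_enorm_gradv phi : test_function Omega phi ->
  leb.-integrable Omega (EFin \o (fun x => enorm (gradv phi x))).
Proof.
move=> tphi; apply: integrable_enorm => // i; under eq_fun do rewrite mxE.
exact: integrable_test_partial.
Qed.

(** On a set of finite measure L^N embeds in L^1, since |f| <= 1 + |f|^N. *)
Lemma Lfun_integrable_bounded f : f \_ Omega \in Lfun leb N%:R%:E ->
  leb.-integrable Omega (EFin \o f).
Proof.
move=> Lf; have mf : measurable_fun setT (f \_ Omega).
  by move: Lf => /andP[]; rewrite inE.
have N1 : (1 <= N%:R :> R)%R by rewrite ler1n.
have i1 : leb.-integrable Omega (EFin \o cst (1%R : R)).
  by apply: integrable_continuous => // x; exact: cst_continuous.
have iN : leb.-integrable Omega (fun x => (`|(f \_ Omega) x| `^ N%:R)%:E).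
  by apply: (integrableS measurableT) => //; exact: Lfun_integrable Lf.
apply: (@eq_integrable _ _ _ _ _ mO (EFin \o (f \_ Omega))).
  by move=> x xO; rewrite /= patchE xO.
apply: le_integrable (integrableD mO i1 iN) => //.
  by apply/measurable_EFinP; exact: measurable_funTS.
move=> x _; rewrite /= lee_fin [leRHS]ger0_norm; last first.
  by rewrite addr_ge0// powR_ge0.
have [h|h] := leP `|(f \_ Omega) x|%R 1%R.
  by rewrite (le_trans h)// lerDl powR_ge0.
rewrite -[leLHS]powRr1// ler_wpDl// ler_powR// ltW//.
Qed.

Lemma integrable_mul_test_function f phi :
  leb.-integrable Omega (EFin \o f) -> test_function Omega phi ->
  leb.-integrable Omega (EFin \o (f \* phi)%R).
Proof.
move=> fi tphi; have cphi := test_function_continuous tphi.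
rewrite (_ : f \* phi = phi \* f)%R; last first.
  by apply/funext => x; exact: mulrC.
have [M phiM] := continuous_bounded bO cphi.
apply: (integrable_EFinM_bounded mO _ phiM fi).
by apply: measurable_funTS; exact: continuous_measurable_rV.
Qed.

End sobolev_hoelder.

Section small_data.
Context {R : realType} {N : nat}.
Variables (Omega : set 'rV[R]_N) (f : 'rV[R]_N -> R) (lambda : R).
Hypotheses (N0 : (0 < N)%N) (oO : open Omega) (bO : bounded_set Omega).
Hypothesis Lf : f \_ Omega \in Lfun leb N%:R%:E.
Hypothesis f0 : {ae leb, forall x, Omega x -> 0 <= f x}.
Hypothesis lf0 : {ae leb, forall x, Omega x -> 0 <= lambda * f x}.
Hypothesis small :
  (lambda%:E < 1 / (sobolev_constant N 1 * Lpnorm Omega N%:R%:E f))%E.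

Let mO : measurable Omega. Proof. exact: open_measurable_rV. Qed.

Let mf : measurable_fun setT (f \_ Omega).
Proof. by move: Lf => /andP[]; rewrite inE. Qed.

Let normf_fin : Lpnorm Omega N%:R%:E f \is a fin_num.
Proof.
rewrite ge0_fin_numE ?Lnorm_ge0//.
by move: Lf => /andP[_]; rewrite inE.
Qed.

Let normf_eq0 : Lpnorm Omega N%:R%:E f = 0%E <->
  {ae leb, forall x, Omega x -> f x = 0}.
Proof.
have /measurable_EFinP mfE := mf.
split=> [/Lnorm_eq0_eq0|fae].
  move=> /(_ mfE).
  rewrite lte_fin ltr0n => /(_ N0); apply: filterS => x /(_ I) + Ox.
  by rewrite /= patchE mem_set// => -[].
have -> : Lpnorm Omega N%:R%:E f = ('N[@lebesgue_rV R N]_N%:R%:E[cst 0])%E.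
  rewrite /Lpnorm unlock; congr (_ `^ _)%E; apply: ae_eq_integral => //.
    apply: (measurableT_comp (measurable_poweR _)) => //.
    by apply: measurableT_comp => //; exact/measurable_EFinP.
  apply: filterS fae => x fx _; rewrite /= patchE; case: ifPn => // xO.
  by rewrite fx//; exact: set_mem.
by rewrite Lnorm0// eqe pnatr_eq0 -lt0n.
Qed.

(** The Sobolev constant is an infimum; as lambda |f|_N times it is strictly less
than 1, some admissible constant S still satisfies lambda |f|_N S <= 1. *)
Let sobolev_lt : 0 < lambda -> Lpnorm Omega N%:R%:E f != 0%E ->
  exists2 S : R, 0 <= S /\ (forall phi, test_function Omega phi ->
    (Lpnorm Omega (sobolev_exponent N 1) phi <=
      S%:E * vLpnorm Omega 1%:E (gradv phi))%E) &
    lambda * fine (Lpnorm Omega N%:R%:E f) * S <= 1.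
Proof.
move=> l0; move: small; rewrite -(fineK normf_fin) eqe.
set n := fine _ => smalln nn0.
have n0 : 0 < n by rewrite lt0r nn0 fine_ge0// Lnorm_ge0.
have S0 : (0 <= sobolev_constant (R := R) N 1)%E.
  by apply: le_ereal_inf_tmp => _ [S [S0 _] <-]; rewrite lee_fin.
have : (sobolev_constant N 1 < ((lambda * n)^-1)%:E)%E.
  move: smalln S0; case: (sobolev_constant N 1) => [s| |]//.
  - rewrite -EFinM inver lee_fin !lte_fin => + s0.
    have [->|s1] := eqVneq s 0; first by rewrite invr_gt0 mulr_gt0.
    have {s1}s1 : 0 < s by rewrite lt0r s1.
    rewrite mulf_eq0 !gt_eqF//= mul1e lte_fin => h.
    rewrite -[X in X < _]invrK ltf_pV2 ?posrE ?invr_gt0 ?mulr_gt0//.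
    by rewrite -ltr_pdivlMr// -invfM.
  - by rewrite gt0_mulye ?lte_fin// mulr0 ltNge (ltW l0).
rewrite /sobolev_constant => /ereal_inf_lt[_ [S [S1 SP] <-]]; rewrite lte_fin => Sl.
exists S; first split=> // phi tphi.
  apply: SP => //; exact: test_function_W01p.
by rewrite /= mulrC -ler_pdivlMr ?mulr_gt0// div1r ltW.
Qed.

(** If f = 0 almost everywhere or lambda <= 0, then lambda f = 0 almost everywhere,
because f and lambda f are both nonnegative.  Otherwise the estimate is Hoelder
followed by Sobolev. *)
Lemma small_data_estimate phi : test_function Omega phi ->
  \int[leb]_(x in Omega) (lambda * f x * phi x) <=
  \int[leb]_(x in Omega) enorm (gradv phi x).
Proof.
move=> tphi; set G := (leRHS).
have G0 : 0 <= G by apply: Rintegral_ge0 => x _; exact: enorm_ge0.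
have mfO : measurable_fun Omega f.
  exact: integrable_EFin_measurable (Lfun_integrable_bounded N0 oO bO Lf).
have mphi : measurable_fun Omega phi.
  exact: integrable_EFin_measurable (integrable_test_function oO bO tphi).
have mh : measurable_fun Omega (fun x => lambda * f x * phi x).
  by apply: measurable_funM => //; exact: measurable_funM.
have zero : {ae leb, forall x, Omega x -> lambda * f x = 0} ->
    \int[leb]_(x in Omega) (lambda * f x * phi x) <= G.
  move=> lfz; rewrite /Rintegral (ae_eq_integral (cst 0%E)) ?integral0//.
  - exact/measurable_EFinP.
  - by apply: filterS lfz => x + Ox => ->//=; rewrite mul0r.
have [fz|fnz] := eqVneq (Lpnorm Omega N%:R%:E f) 0%E.
  apply: zero; move/normf_eq0 : fz; apply: filterS => x h /h ->.
  by rewrite mulr0.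
have [l0|l0] := leP lambda 0.
  apply: zero; apply: filterS2 f0 lf0 => x h1 h2 Ox.
  by apply/eqP; rewrite eq_le h2// andbT mulr_le0_ge0// h1.
have [S [S0 SP] Sle] := sobolev_lt l0 fnz.
set h := fun x => lambda * f x * phi x.
have GE : vLpnorm Omega 1 (gradv phi) = G%:E.
  rewrite /vLpnorm Lpnorm1E /G /Rintegral fineK.
    by apply: eq_integral => x _; rewrite ger0_norm// enorm_ge0.
  by apply: integrable_fin_num => //; exact: integrable_enorm_gradv.
have hG : (\int[leb]_(x in Omega) `|h x|%:E <= G%:E)%E.
  under eq_integral => x _ do rewrite /h -mulrA normrM (gtr0_norm l0) EFinM.
  rewrite ge0_integralZl//.
  - have := SP phi tphi; rewrite GE -EFinM => SG.
    have mphiO : measurable_fun setT (phi \_ Omega).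
      by apply/(measurable_restrictT _ mO).
    apply: (@le_trans _ _ (lambda%:E * (Lpnorm Omega N%:R%:E f * (S * G)%:E))%E).
      rewrite lee_wpmul2l ?lee_fin ?(ltW l0)//.
      apply: le_trans (Lpnorm_hoelder_critical N0 mf mphiO) _.
      by rewrite lee_wpmul2l ?Lnorm_ge0.
    rewrite -(fineK normf_fin) -!EFinM lee_fin !mulrA.
    by rewrite ler_piMl.
  - by do 2 apply: measurableT_comp => //; exact: measurable_funM.
  - by rewrite lee_fin ltW.
have /measurable_EFinP mhE := mh.
have := le_abse_integral leb mO mhE; move=> /le_trans/(_ hG).
rewrite /Rintegral /h; case: integral => [r||]//=.
by rewrite lee_fin; exact: le_trans (ler_norm _).
Qed.

End small_data.

(** * A bounded vector field with prescribed divergence *)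

Section calibration.
Context {R : realType} {N : nat}.
Variables (Omega : set 'rV[R]_N) (g : 'rV[R]_N -> R).
Hypotheses (oO : open Omega) (bO : bounded_set Omega).
Hypothesis ig : leb.-integrable Omega (EFin \o g).
Hypothesis g_le : forall phi, test_function Omega phi ->
  \int[leb]_(x in Omega) (g x * phi x) <=
  \int[leb]_(x in Omega) enorm (gradv phi x).

Let mO : measurable Omega. Proof. exact: open_measurable_rV. Qed.
Let fO : (leb Omega < +oo)%E. Proof. exact: bounded_leb_lty. Qed.

Let mu : {finite_measure set 'rV[R]_N -> \bar R} := mfrestr mO fO.
Let L := LfunType mu (lexx 1%E).
(** The space of integrable vector fields.  Genuine functions are used instead of
classes modulo equality almost everywhere: a seminorm is enough for the
Hahn-Banach theorem. *)
Let V : lmodType R := 'I_N -> L.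

Let X := 'rV[R]_N.
Local Notation int f := (mu.-integrable setT (EFin \o f)).

Let fL (F : V) : 'I_N -> X -> R := fun i => F i : X -> R.
(** Any function may be inserted in L^1, with the junk value 0 when it is not
integrable; this lets functionals on L^1 act on bare functions. *)
Let toL (f : X -> R) : L := insubd (0 : L) f.

Let toLE f : int f -> (toL f : X -> R) = f.
Proof. by move=> fi; rewrite /toL (insubdK 0)//; apply/Lfun1_integrable. Qed.

Let int_L (h : L) : int h.
Proof. by apply/Lfun1_integrable; exact: valP. Qed.

Let toLD f1 f2 : int f1 -> int f2 -> toL (f1 \+ f2) = toL f1 + toL f2.
Proof.
move=> i1 i2; apply/val_inj; rewrite /= toLE; last exact: integrable_EFinD.
by apply/funext => x /=; rewrite /= -[in LHS](toLE i1) -[in LHS](toLE i2).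
Qed.

Let toLZ a f : int f -> toL (a \*: f) = a *: toL f.
Proof.
move=> i1; apply/val_inj; rewrite /= toLE; last exact: integrable_EFinZ.
by apply/funext => x /=; rewrite -[in LHS](toLE i1).
Qed.

Let gradL phi : V := fun i => toL (partial i phi).

Let int_partial phi i : test_function Omega phi -> int (partial i phi).
Proof.
move=> tphi; apply: integrable_mfrestr; last exact: integrable_test_partial.
apply/measurable_EFinP; apply: continuous_measurable_rV.
exact: test_function_partial_continuous tphi.
Qed.

Let row_gradL phi x : test_function Omega phi ->
  row_fun (fL (gradL phi)) x = gradv phi x.
Proof. by move=> tphi; apply/rowP => i; rewrite !mxE /fL /gradL toLE//; exact: int_partial. Qed.

Let int_enorm (F : V) : int (fun x => enorm (row_fun (fL F) x)).
Proof.
by apply: integrable_enorm => // i; under eq_fun do rewrite mxE; exact: int_L.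
Qed.

Let load phi := \int[leb]_(x in Omega) (g x * phi x).

Let int_load phi : test_function Omega phi ->
  leb.-integrable Omega (EFin \o (g \* phi)).
Proof. exact: integrable_mul_test_function. Qed.

Let loadD phi psi : test_function Omega phi -> test_function Omega psi ->
  load (phi \+ psi) = load phi + load psi.
Proof.
move=> tphi tpsi; rewrite /load -RintegralD//; [|exact: int_load..].
by apply: eq_Rintegral => x _ /=; rewrite mulrDr.
Qed.

Let loadZ a phi : test_function Omega phi -> load (a \*: phi) = a * load phi.
Proof.
move=> tphi; rewrite /load -RintegralZl//; last exact: int_load.
by apply: eq_Rintegral => x _ /=; rewrite mulrCA.
Qed.

Let row_fLD (F G : V) x :
  row_fun (fL (F + G)) x = row_fun (fL F) x + row_fun (fL G) x.
Proof. by apply/rowP => i; rewrite !mxE. Qed.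

Let row_fLZ a (F : V) x : row_fun (fL (a *: F)) x = a *: row_fun (fL F) x.
Proof. by apply/rowP => i; rewrite !mxE. Qed.

Let gradLD phi psi : test_function Omega phi -> test_function Omega psi ->
  gradL (phi \+ psi) = gradL phi + gradL psi.
Proof.
move=> tphi tpsi; have [sphi _ _] := tphi; have [spsi _ _] := tpsi.
apply/funext => i.
rewrite -[RHS]/(toL (partial i phi) + toL (partial i psi)) /gradL.
rewrite -toLD; [|exact: int_partial..].
congr toL; apply/funext => x; rewrite partialD//.
- exact: (sphi [::]).2.
- exact: (spsi [::]).2.
Qed.

Let gradLZ a phi : test_function Omega phi -> gradL (a \*: phi) = a *: gradL phi.
Proof.
move=> tphi; have [sphi _ _] := tphi.
apply/funext => i; rewrite -[RHS]/(a *: toL (partial i phi)) /gradL.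
rewrite -toLZ; last exact: int_partial.
by congr toL; apply/funext => x; rewrite partialZ//; exact: (sphi [::]).2.
Qed.

Let mass (F : V) : R := \int[mu]_x enorm (row_fun (fL F) x).

Let massD (F G : V) : mass (F + G) <= mass F + mass G.
Proof.
rewrite /mass -RintegralD//.
apply: le_Rintegral => //; first exact: integrable_EFinD.
by move=> x _; rewrite row_fLD ler_enormD.
Qed.

Let massZ a (F : V) : mass (a *: F) = `|a| * mass F.
Proof.
rewrite /mass -RintegralZl//.
by apply: eq_Rintegral => x _; rewrite row_fLZ enormZ.
Qed.

Let mass_gradL phi : test_function Omega phi ->
  mass (gradL phi) = \int[leb]_(x in Omega) enorm (gradv phi x).
Proof.
move=> tphi; rewrite /mass Rintegral_mfrestr; last exact: int_enorm.
by apply: eq_Rintegral => x _; rewrite row_gradL.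
Qed.

Let A : set (X -> R) := [set phi | test_function Omega phi].

(** The functional grad phi |-> int g phi is bounded by the L^1 norm of the gradient;
z represents a Hahn-Banach extension of it. *)
Lemma exists_calibration : exists z : X -> 'rV[R]_N,
  [/\ forall i, measurable_fun setT (fun x => z x ord0 i),
      forall x, enorm (z x) <= 1 &
      forall phi, test_function Omega phi ->
        \int[leb]_(x in Omega) dotv (z x) (gradv phi x) =
        \int[leb]_(x in Omega) (g x * phi x)].
Proof.
have [||||||||||T [TD TZ T_mass T_grad]] := @hahn_banach_extension R (X -> R : lmodType R) V A gradL load mass.
- exact: test_function0.
- exact: test_functionD.
- exact: test_functionZ.
- exact: gradLD.
- exact: gradLZ.
- exact: loadD.
- exact: loadZ.
- exact: massD.
- exact: massZ.
- by move=> phi tphi; rewrite mass_gradL//; exact: g_le.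
pose T' (F : 'I_N -> X -> R) := T (fun i => toL (F i)).
have [||F iF|z [mz z1 zT]] := @L1_dual_vector _ _ _ _ mu T'.
- move=> F G iF iG; rewrite /T' -TD; congr T; apply/funext => i.
  by rewrite toLD.
- move=> a F iF; rewrite /T' -TZ; congr T; apply/funext => i.
  by rewrite toLZ.
- apply: le_trans (T_mass _) _; rewrite le_eqVlt; apply/orP; left; apply/eqP.
  by apply: eq_Rintegral => x _; congr enorm; apply/rowP => i; rewrite !mxE /fL toLE.
exists z; split=> // phi tphi.
rewrite -[RHS]/(load phi) -T_grad//.
have := zT (fun i => partial i phi); rewrite {1}/T' -/(gradL phi) => ->; last first.
  by move=> i; exact: int_partial.
rewrite Rintegral_mfrestr//.
rewrite (_ : _ \o _ = fun x => (\sum_i (z x ord0 i * partial i phi x)%:E)%E).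
  apply: integrable_sum => // i _.
  apply: (@integrable_EFinM_bounded _ _ _ mu _ (fun x => z x ord0 i) _ 1) => //.
    by move=> x _; exact: le_trans (abs_coord_le_enorm _ _) (z1 x).
  exact: int_partial.
apply/funext => x /=; rewrite -sumEFin; apply: eq_bigr => i _.
by rewrite mxE.
Qed.

End calibration.

(** * Integration against charges *)

Section charge_integrals.
Local Open Scope charge_scope.
Context d (X : measurableType d) (R : realType).

Lemma charge_integral_czero (D : set X) (f : X -> R) :
  charge_integral (@czero _ X R) D f = 0.
Proof.
rewrite /charge_integral /Rintegral; set P := hahn_posneg _.
have zero_int (m : {measure set X -> \bar R}) : (forall A, m A = 0%E) ->
    (\int[m]_(x in D) (f x)%:E = 0)%E.
  by move=> m0; rewrite (eq_measure_integral mzero) ?integral_measure_zero.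
have jp0 A : jordan_pos P A = 0%E.
  by rewrite /jordan_pos /= /measure_of_charge /= /crestr0 /crestr; case: ifP.
have jn0 A : jordan_neg P A = 0%E.
  rewrite jordan_negE cjordan_negE /crestr0 /crestr.
  by case: ifP => _; exact: oppe0.
rewrite [X in fine X - _]zero_int; last exact: jp0.
rewrite [X in _ - fine X]zero_int; last exact: jn0.
exact: subrr.
Qed.

Variable mu : {sigma_finite_measure set X -> \bar R}.

(** A function integrates against each part of the Jordan decomposition as against
its Radon-Nikodym density, and the difference of the two densities is h almost
everywhere. *)
Lemma charge_integral_induced (h phi : X -> R) (D : set X) (M : R)
    (ih : mu.-integrable setT (EFin \o h)) :
  measurable D -> measurable_fun D phi -> (forall x, D x -> `|phi x| <= M) ->
  charge_integral (induced_charge ih) D phi = \int[mu]_(x in D) (h x * phi x).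
Proof.
move=> mD mphi phiM; rewrite /charge_integral.
set nu := induced_charge ih.
set P := hahn_posneg _.
have nu_mu : nu `<< mu.
  apply/null_content_dominatesP => A mA muA.
  by rewrite /nu /induced_charge null_set_integral//;
    apply: measurable_funTS; exact: measurable_int ih.
pose jp : {finite_measure set X -> \bar R} := jordan_pos P.
pose jn : {finite_measure set X -> \bar R} := jordan_neg P.
have jp_mu : jp `<< mu by exact: jordan_pos_dominates.
have jn_mu : jn `<< mu by exact: jordan_neg_dominates.
pose rp := 'd (charge_of_finite_measure jp) '/d mu.
pose rn := 'd (charge_of_finite_measure jn) '/d mu.
have change (j : {finite_measure set X -> \bar R}) : j `<< mu ->
    let r := 'd (charge_of_finite_measure j) '/d mu in
    mu.-integrable D (EFin \o (fun x => phi x * fine (r x))) /\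
    \int[j]_(x in D) phi x = \int[mu]_(x in D) (phi x * fine (r x)).
  move=> j_mu r.
  have rE x : (fine (r x))%:E = r x.
    by rewrite fineK//; exact: Radon_Nikodym_fin_num.
  split.
    apply: (integrable_EFinM_bounded mD mphi phiM).
    rewrite (_ : _ \o _ = r); last by apply/funext => x /=; rewrite rE.
    by apply: (integrableS measurableT) => //; exact: Radon_Nikodym_integrable.
  have iphi : j.-integrable D (EFin \o phi).
    apply: measurable_bounded_integrable => //.
      by rewrite ltey_eq fin_num_measure.
    exists M; split; [exact: num_real|move=> K MK x /= Dx].
    exact: le_trans (phiM x Dx) (ltW MK).
  rewrite /Rintegral -(Radon_Nikodym_change_of_variables j_mu mD iphi).
  by congr fine; apply: eq_integral => x _; rewrite EFinM rE.
have [ip Ep] := change jp jp_mu; have [in_ En] := change jn jn_mu.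
rewrite -/jp -/jn Ep En -RintegralB//; congr fine.
have rh : ae_eq mu setT (rp \- rn)%E (EFin \o h).
  apply: integral_ae_eq => //.
  - by apply: integrableB => //; exact: Radon_Nikodym_integrable.
  - exact: measurable_int ih.
  - move=> A _ mA; rewrite integralB//; last 2 first.
      by apply: (integrableS measurableT) => //; exact: Radon_Nikodym_integrable.
      by apply: (integrableS measurableT) => //; exact: Radon_Nikodym_integrable.
    rewrite -!Radon_Nikodym_integral//.
    by have := jordan_decomp P mA; rewrite /cadd/= cscaleN1/= => /esym.
have mh : measurable_fun D h.
  by apply: measurable_funTS; exact: integrable_EFin_measurable ih.
apply: ae_eq_integral => //.
- exact: measurable_int (integrable_EFinB mD ip in_).
- by apply/measurable_EFinP; exact: measurable_funM.
apply: filterS rh => x /(_ I) /= rhx Dx; rewrite -mulrBr mulrC; congr (_ * _)%:E.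
apply: EFin_inj; rewrite -rhx EFinB !fineK//; exact: Radon_Nikodym_fin_num.
Qed.

End charge_integrals.

(** * The zero function as a function of bounded variation *)

Section zero_solution.
Context {R : realType} {N : nat}.
Implicit Types (x nu : 'rV[R]_N) (Omega : set 'rV[R]_N).
Local Notation u0 := (cst 0 : 'rV[R]_N -> R).

Lemma total_variation_czero (A : set 'rV[R]_N) : measurable A ->
  Defs.total_variation (fun i : 'I_N => @czero _ 'rV[R]_N R) A = 0%E.
Proof.
move=> mA; rewrite /Defs.total_variation.
have zero F : (\sum_(0 <= k <oo)
    (enorm (vcharge_val (fun i : 'I_N => @czero _ 'rV[R]_N R) (F k)))%:E = 0)%E.
  apply: eseries0 => k _ _; rewrite (_ : vcharge_val _ _ = 0) ?enorm0//.
  by apply/rowP => i; rewrite !mxE.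
rewrite [X in ereal_sup X](_ : _ = [set 0%E]) ?ereal_sup1//.
apply/seteqP; split=> [_ [F _ <-] /=|_ ->]; first exact: zero.
exists (fun k : nat => if k == 0%N then A else set0); last exact: zero.
split.
- by move=> k; case: ifP.
- by move=> [|i] [|j] _ _ //= [t []].
- by apply/seteqP; split=> [t [[|k] _]//|t At]; exists 0%N.
Qed.

Lemma hausdorff_measure0 s : hausdorff_measure s (set0 : set 'rV[R]_N) = 0%E.
Proof.
rewrite /hausdorff_measure.
rewrite [X in ereal_sup X](_ : _ = [set 0%E]) ?ereal_sup1//.
have zero (delta : R) : 0 < delta -> ereal_inf
    [set (\sum_(0 <= k <oo) if `[< F k = set0 >] then 0 else diam (F k) ^+ s)%E
       | F in [set F : (set 'rV[R]_N)^nat |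
           set0 `<=` \bigcup_k F k /\ forall k, (diam (F k) <= delta%:E)%E]] = 0%E.
  move=> d0; apply/eqP; rewrite eq_le; apply/andP; split.
    apply: ereal_inf_lbound; exists (fun=> set0).
      split=> // k; rewrite /diam (_ : [set _ | _ in _ & _ in _] = set0).
        by rewrite ereal_sup0 leNye.
      by apply/seteqP; split=> // t [x []].
    by apply: eseries0 => k _ _; case: asboolP.
  apply: le_ereal_inf_tmp => _ [F _ <-]; apply: nneseries_ge0 => k _ _.
  case: asboolP => // /eqP/set0P[x Fx]; apply: expe_ge0.
  by apply: ereal_sup_ubound; exists x => //; exists x => //; rewrite subrr enorm0.
apply/seteqP; split=> [_ [delta /= d0 <-]|_ ->]; first exact: zero.
by exists 1 => //=; exact: zero.
Qed.

(** The mean deviation of 0 from a is |a| at every scale, as soon as the averaging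
sets have positive finite measure. *)
Lemma mean_dev_cst0_cvg (D : R -> set 'rV[R]_N) (a : R) :
  (forall r, 0 < r -> [/\ measurable (D r), (0 < leb (D r))%E & (leb (D r) < +oo)%E]) ->
  (mean_dev u0 D a r @[r --> 0^'+] --> 0)%E -> a = 0.
Proof.
move=> DP /cvg_lim => /(_ (@ereal_hausdorff R)) lim0.
suff : (mean_dev u0 D a r @[r --> 0^'+] --> `|a|%:E)%E.
  move=> /cvg_lim => /(_ (@ereal_hausdorff R)); rewrite lim0 => -[] /esym/eqP.
  by rewrite normr_eq0 => /eqP.
apply: cvg_near_cst; near=> r.
have [mD D0 Doo] : [/\ measurable (D r), (0 < leb (D r))%E & (leb (D r) < +oo)%E].
  by apply: DP; near: r; exact: nbhs_right_gt.
rewrite /mean_dev; under eq_integral do rewrite sub0r normrN.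
rewrite integral_cst// muleCA.
by rewrite mulVe ?mule1// ?gt_eqF// gt0_fin_numE.
Unshelve. all: by end_near. Qed.

Lemma approx_limit_cst0 x a : approx_limit u0 x a -> a = 0.
Proof.
apply: mean_dev_cst0_cvg => r r0; split; last exact: leb_eball_lty.
- by apply: open_measurable_rV; exact: open_eball.
- apply: (@open_leb_gt0 _ _ _ x); first exact: open_eball.
  by rewrite /eball/= subrr enorm0.
Qed.

Lemma half_ball_mean_cst0 x nu a : enorm nu = 1 ->
  (mean_dev u0 (half_ball x nu) a r @[r --> 0^'+] --> 0)%E -> a = 0.
Proof.
move=> nu1; apply: mean_dev_cst0_cvg => r r0.
have mB : measurable (half_ball x nu r).
  by apply: open_measurable_rV; exact: open_half_ball.
split=> //.
- apply: (@open_leb_gt0 _ _ _ (x + (r / 2) *: nu)); first exact: open_half_ball.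
  split; rewrite /eball/= addrAC subrr add0r.
    rewrite enormZ nu1 mulr1 ger0_norm; lra.
  rewrite dotvZl -enorm_sqr nu1 expr1n mulr1; lra.
- apply: le_lt_trans (leb_eball_lty x r); apply: le_measure; rewrite ?inE//.
    by apply: open_measurable_rV; exact: open_eball.
  exact: subIsetl.
Qed.

(** The only approximate limit of 0 is 0, and 0 has no jump since both one-sided
limits would be 0. *)
Lemma precise_rep_cst0 x : precise_rep u0 x = 0.
Proof.
rewrite /precise_rep; case: xgetP => // t _ [/approx_limit_cst0//|].
move=> [a [b [nu [[ab nu1 ha hb] _]]]]; move: ab.
rewrite (half_ball_mean_cst0 nu1 ha) (half_ball_mean_cst0 _ hb) ?eqxx//.
by rewrite enormN.
Qed.

Lemma zero_trace_cst0 Omega : zero_trace Omega u0.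
Proof.
rewrite /zero_trace (_ : mkset _ = set0) ?hausdorff_measure0//.
apply/seteqP; split=> // x [_ /=]; apply.
rewrite /trace_at; apply: cvg_near_cst; apply: nearW => r.
by rewrite integral0_eq ?mule0// => y _; rewrite subrr normr0.
Qed.

Lemma absorption_density_cst0 (gamma : R) x :
  absorption_density gamma u0 x = 1%E.
Proof. by rewrite /absorption_density precise_rep_cst0 subr0 powR1 inve1. Qed.

End zero_solution.

(** * Existence of a solution *)

Theorem theorem2 (R : realType) (N : nat) (Omega : set 'rV[R]_N)
    (f : 'rV[R]_N -> R) (lambda gamma : R) :
  (0 < N)%N ->
  open Omega -> bounded_set Omega ->
  f \_ Omega \in Lfun leb N%:R%:E ->
  {ae leb, forall x, Omega x -> 0 <= f x} ->
  {ae leb, forall x, Omega x -> 0 <= lambda * f x} ->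
  (lambda%:E < 1 / (sobolev_constant N 1 * Lpnorm Omega N%:R%:E f))%E ->
  0 <= gamma ->
  exists u : 'rV[R]_N -> R,
    BV Omega u /\ is_solution Omega gamma (fun x => lambda * f x) u.
Proof.
move=> N0 oO bO Lf f0 lf0 small _.
have mO : measurable Omega by exact: open_measurable_rV.
pose g x := lambda * f x.
have ig : leb.-integrable Omega (EFin \o g).
  by apply: integrable_EFinZ => //; exact: Lfun_integrable_bounded Lf.
have [z [mz z1 zE]] : exists z : 'rV[R]_N -> 'rV[R]_N,
    [/\ forall i, measurable_fun setT (fun x => z x ord0 i),
        forall x, enorm (z x) <= 1 &
        forall phi, test_function Omega phi ->
          \int[leb]_(x in Omega) dotv (z x) (gradv phi x) =
          \int[leb]_(x in Omega) (g x * phi x)].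
  apply: exists_calibration => // phi tphi.
  exact: small_data_estimate.
(* The divergence of z is the charge with density - g, extended by 0 outside
   Omega. *)
have igO : leb.-integrable setT (EFin \o (\- (g \_ Omega))).
  rewrite (_ : _ \o _ = -%E \o (EFin \o (g \_ Omega)))//; apply: integrableN.
  rewrite (_ : _ \o _ = (EFin \o g) \_ Omega); last by rewrite restrict_EFin.
  by apply/integrable_restrict; rewrite ?setTI.
pose dz : {charge set 'rV[R]_N -> \bar R} := induced_charge igO.
have dzE phi : test_function Omega phi ->
    - charge_integral dz Omega phi = \int[leb]_(x in Omega) (g x * phi x).
  move=> tphi; have cphi := test_function_continuous tphi.
  have [M phiM] := continuous_bounded bO cphi.
  rewrite (charge_integral_induced igO mO _ phiM); last first.
    by apply: measurable_funTS; exact: continuous_measurable_rV.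
  have -> : \int[leb]_(x in Omega) ((\- (g \_ Omega)) x * phi x) =
      \int[leb]_(x in Omega) (-1 * (g x * phi x)).
    by apply: eq_Rintegral => x xO /=; rewrite patchE xO mulN1r mulNr.
  rewrite RintegralZl ?mulN1r ?opprK//.
  exact: integrable_mul_test_function.
have z_le1 : (vLpnorm Omega +oo z <= 1)%E.
  rewrite /vLpnorm /Lpnorm unlock; case: ifPn => // _.
  apply/ess_supP/nearW => x; rewrite /= patchE lee_fin.
  by case: ifP => _ /=; [rewrite ger0_norm ?enorm_ge0|rewrite normr0].
pose D0 (i : 'I_N) : {charge set 'rV[R]_N -> \bar R} := czero.
have D0u : BV_derivative Omega (cst 0) D0.
  split=> [|i A _ _|phi _ i]//.
    exact: integrable0.
  rewrite charge_integral_czero oppr0; under eq_Rintegral do rewrite mul0r.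
  by rewrite Rintegral_cst// mul0r.
exists (cst 0); split; first by exists D0.
exists D0, D0, D0, D0, mzero, z, dz; split.
- split=> // A mA; exact/esym/total_variation_czero.
- by apply: aeW => x _; rewrite lexx ltr01.
- split; last exact: total_variation_czero.
  exists set0; split=> //.
- split=> //; split.
  + by apply: measurable_funTS; exact: measurable_fun_rV.
  + by apply: le_lt_trans z_le1 _; rewrite ltry.
  + move=> A mA AO; rewrite /dz /= /induced_charge integral0_eq// => x Ax.
    rewrite /= patchE; case: ifPn => [/set_mem Ox|]; last by rewrite oppr0.
    by have : (A `&` Omega) x by []; rewrite AO.
  + by move=> phi tphi; rewrite zE// dzE.
- split.
  + split=> [K kK KO|phi tphi].
      rewrite (_ : absorption_density _ _ = cst 1%E); last first.
        by apply/funext => x; exact: absorption_density_cst0.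
      apply/integrableP; split; first exact: measurable_cst.
      by rewrite integral_measure_zero ltry.
    rewrite integral_measure_zero addr0; exact: dzE.
  + move=> phi tphi; rewrite /pairing.
    rewrite (_ : (fun x => precise_rep _ x * phi x) = cst 0); last first.
      by apply/funext => x; rewrite precise_rep_cst0 mul0r.
    under eq_Rintegral do rewrite mul0r.
    rewrite /charge_integral !Rintegral_cst// !mul0r !subr0 oppr0.
    by rewrite /Rintegral integral_measure_zero.
  + exact: zero_trace_cst0.
Qed.
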